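(* Let $f_1,\dots,f_N:\mathbb{R}^N\to\mathbb{R}$ be the players' cost functions. Suppose that: (1) each $f_i$ is a $\mathcal{C}^2$ function; (2) the players are equipped with a communication graph $\mathcal{G}$ on the node set $\{1,\dots,N\}$ which is undirected and connected; (3) there exists a constant $m>0$ such that $(\mathbf{x}-\mathbf{z})^T(\bar{\mathcal{P}}(\mathbf{x})-\bar{\mathcal{P}}(\mathbf{z}))\ge m\|\mathbf{x}-\mathbf{z}\|^2$ for all $\mathbf{x},\mathbf{z}\in\mathbb{R}^N$, where $\bar{\mathcal{P}}(\mathbf{x})=[\nabla_1f_1(\mathbf{x}),\dots,\nabla_Nf_N(\mathbf{x})]^T$; (4) the entries of the matrix $H(\mathbf{x})=\left[\frac{\partial^2f_i(\mathbf{x})}{\partial x_i\partial x_j}\right]$ are bounded for $\mathbf{x}\in\mathbb{R}^N$. Let $\bar U>0$ and let $\bar\theta_{ij}>0$, $i,j\in\{1,\dots,N\}$, be fixed constants. For $\theta>0$ put $\theta_{ij}=\theta\bar\theta_{ij}$ and consider the system $$\dot x_i=-\rho_{\bar U}\big(\nabla_if_i(\mathbf{y}_i)\big),\qquad \dot y_{ij}=-\theta_{ij}\Big(\sum_{k=1}^Na_{ik}(y_{ij}-y_{kj})+a_{ij}(y_{ij}-x_j)\Big),\qquad i,j\in\{1,\dots,N\}.$$ Then there exists $\theta^*$ such that for each $\theta\in(\theta^*,\infty)$ the Nash equilibrium is globally asymptotically stable, i.e. the equilibrium $(\mathbf{x},\mathbf{y})=(\mathbf{x}^*,\mathbf{1}_N\otimes\mathbf{x}^*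 )$ of this system is globally asymptotically stable.
   Context: There is a game with $N\ge 2$ players; player $i$ has action $x_i\in\mathbb{R}$ and cost function $f_i(\mathbf{x})$, $\mathbf{x}=[x_1,\dots,x_N]^T$. Also write $f_i(\mathbf{x})=f_i(x_i,\mathbf{x}_{-i})$ with $\mathbf{x}_{-i}=[x_1,\dots,x_{i-1},x_{i+1},\dots,x_N]^T$. Notation: $\nabla_if_i(\mathbf{x})=\frac{\partial f_i(\mathbf{x})}{\partial x_i}$; $\mathbf{y}_i=[y_{i1},\dots,y_{iN}]^T\in\mathbb{R}^N$ is player $i$'s local estimate of $\mathbf{x}$; $\nabla_if_i(\mathbf{y}_i)=\frac{\partial f_i(\mathbf{x})}{\partial x_i}\big|_{\mathbf{x}=\mathbf{y}_i}$; $\mathbf{y}=[\mathbf{y}_1^T,\dots,\mathbf{y}_N^T]^T\in\mathbb{R}^{N^2}$; $\mathbf{1}_N\in\mathbb{R}^N$ is the all-ones vector and $\otimes$ the Kronecker product. $a_{ij}$ is the $(i,j)$ entry of the adjacency matrix of $\mathcal{G}$ ($a_{ij}=a_{ji}=1$ if $\{i,j\}$ is an edge, $a_{ij}=0$ otherwise, $a_{ii}=0$). A Nash equilibrium is a point $\mathbf{x}^*=(x_i^*,\mathbf{x}_{-i}^* )\in\mathbb{R}^N$ such that $f_i(x_i^*,\mathbf{x}_{-i}^* )\le f_i(x_i,\mathbf{x}_{-i}^* )$ for all $x_i\in\mathbb{R}$ and all $i$. (Under hypothesis (3) it exists and is unique, and it is the unique zero of $\bar{\mathcal P}$.) The saturation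 function is $\rho_{\bar U}(\eta)=\mathrm{sgn}(\eta)\min\{|\eta|,\bar U\}$ for $\eta\in\mathbb{R}$. *)

(* Defs.v *)
From mathcomp Require Import all_boot all_order all_algebra.
From mathcomp Require Import all_classical all_reals all_analysis.

Set Implicit Arguments.
Unset Strict Implicit.
Unset Printing Implicit Defensive.

Import Order.TTheory GRing.Theory Num.Theory.
Import numFieldNormedType.Exports.

Local Open Scope classical_set_scope.
Local Open Scope ring_scope.

(* The norm `|x| that the library puts on 'rV[R]_N is the sup norm; the square
   of the Euclidean norm is dotp x x. *)
Definition dotp (R : realType) (N : nat) (u v : 'rV[R]_N) : R :=
  \sum_(i < N) u 0 i * v 0 i.

Definition partial (R : realType) (N : nat) (i : 'I_N) (g : 'rV[R]_N -> R)
  : 'rV[R]_N -> R := 'D_(delta_mx 0 i) g.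

(* All partial derivatives of order <= k exist everywhere and are continuous.
   Derivability is required explicitly since 'D_v g is a total function. *)
Fixpoint class_C (R : realType) (N k : nat) (g : 'rV[R]_N -> R) : Prop :=
  continuous g /\
  if k is k'.+1 then
    forall i : 'I_N, (forall x, derivable g x (delta_mx 0 i)) /\
                     class_C k' (partial i g)
  else True.

Definition pseudo_gradient (R : realType) (N : nat)
    (f : 'I_N -> 'rV[R]_N -> R) (x : 'rV[R]_N) : 'rV[R]_N :=
  \row_i partial i (f i) x.

(* The entry (i, j) is d/dx_i (d f_i / dx_j). *)
Definition game_hessian (R : realType) (N : nat)
    (f : 'I_N -> 'rV[R]_N -> R) (x : 'rV[R]_N) : 'M[R]_N :=
  \matrix_(i, j) partial i (partial j (f i)) x.

(* The action profile (t, x_{-i}). *)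
Definition deviate (R : realType) (N : nat) (x : 'rV[R]_N) (i : 'I_N) (t : R)
  : 'rV[R]_N := \row_j if j == i then t else x 0 j.

Definition nash_equilibrium (R : realType) (N : nat)
    (f : 'I_N -> 'rV[R]_N -> R) (x : 'rV[R]_N) : Prop :=
  forall (i : 'I_N) (t : R), f i x <= f i (deviate x i t).

Definition undirected_graph (N : nat) (e : rel 'I_N) : Prop :=
  symmetric e /\ irreflexive e.

Definition connected_graph (N : nat) (e : rel 'I_N) : Prop :=
  forall i j : 'I_N, connect e i j.

Definition adjacency (R : realType) (N : nat) (e : rel 'I_N) : 'M[R]_N :=
  \matrix_(i, j) (e i j)%:R.

Definition saturation (R : realType) (U eta : R) : R :=
  Num.sg eta * Num.min `|eta| U.

(* Solutions on [0, +oo[ of u' = F u. For continuous F this forces the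
   one-sided derivative of u at 0 to be F (u 0) as well. *)
Definition ode_solution (R : realType) (V : normedModType R)
    (F : V -> V) (u : R -> V) : Prop :=
  {within `[0, +oo[, continuous u} /\
  forall t : R, 0 < t -> is_derive t 1 u (F (u t)).

Definition lyapunov_stable (R : realType) (V : normedModType R)
    (F : V -> V) (p : V) : Prop :=
  forall eps : R, 0 < eps -> exists delta : R, 0 < delta /\
    forall u : R -> V, ode_solution F u -> `|u 0 - p| < delta ->
      forall t : R, 0 <= t -> `|u t - p| < eps.

(* The second conjunct (every initial state has a forward solution) prevents
   the two statements about all solutions from being vacuous. *)
Definition globally_asymptotically_stable (R : realType)
    (V : normedModType R) (F : V -> V) (p : V) : Prop :=
  [/\ F p = 0,
      forall u0 : V, exists u : R -> V, ode_solution F u /\ u 0 = u0,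
      lyapunov_stable F p
    & forall u : R -> V, ode_solution F u -> u t @[t --> +oo] --> p].

(* A state is a pair (x, y), where y_i is row i of the matrix y. *)
Definition seeking_dynamics (R : realType) (N : nat)
    (f : 'I_N -> 'rV[R]_N -> R) (a : 'M[R]_N) (U : R)
    (theta : 'I_N -> 'I_N -> R) (s : 'rV[R]_N * 'M[R]_N)
  : 'rV[R]_N * 'M[R]_N :=
  let: (x, y) := s in
  (\row_i (- saturation U (partial i (f i) (row i y))),
   \matrix_(i, j) (- theta i j *
     (\sum_(k < N) a i k * (y i j - y k j) + a i j * (y i j - x 0 j)))).

(* The state (x, 1_N \otimes x): every row of the estimate matrix is x. *)
Definition consensus_state (R : realType) (N : nat) (x : 'rV[R]_N)
  : 'rV[R]_N * 'M[R]_N := (x, \matrix_(i, j) x 0 j).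

(* Main.v *)
Require Import Defs.
From mathcomp Require Import all_boot all_order all_algebra.
From mathcomp Require Import all_classical all_reals all_analysis.
From mathcomp Require Import ring lra.

Set Implicit Arguments.
Unset Strict Implicit.
Unset Printing Implicit Defensive.

Import Order.TTheory GRing.Theory Num.Theory.
Import numFieldNormedType.Exports.

Local Open Scope classical_set_scope.
Local Open Scope ring_scope.

(** Write [P] for the pseudo-gradient, [rho] for the saturation, [r_i] for
    [rho (P_i x)] and [e_ij = y_ij - x_j] for the estimation errors.

    Nash equilibria are the zeros of [P] because each cost is convex along its
    own coordinate ([nash_equilibriumP]).  The bound on the Hessian makes [P]
    Lipschitz ([pseudo_gradient_lipschitz]), so that [x - c P x] is, for a small
    [c > 0], a contraction of the Euclidean norm; its fixed point is the unique
    zero [x*] of [P] ([strongly_monotone_zero]).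

    For stability, the squared distance to [x*] is of no use: saturating a
    monotone map componentwise may destroy its monotonicity.  The potential
    [sum_i Phi (P_i x)] works, where [Phi] is the Huber function, the primitive
    of [rho].  Along [x' = - rho (P x)] it decreases at rate
    [r^T (DP) r >= m |r|^2]; evaluating [P_i] at the estimates instead of [x]
    costs at most a multiple of [|r| |e|].  The weighted squared error
    [sum_ij e_ij^2 / (2 thetabar_ij)] decreases at rate [theta] times the
    quadratic forms of the grounded graph Laplacians, which are positive
    definite because the graph is connected ([consensus_form_pos_def]), up to
    terms [|e| |x'|].  For [theta] large, the quadratic form in [(|r|, |e|)]
    bounding the rate of the total energy is negative definite
    ([energy_rate_le]).

    On a sublevel set of the energy, [Phi p] is at most a multiple of
    [(rho p)^2], so the energy is at most a multiple of its rate of decrease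
    ([energy_le_dissipation]) and tends to [0] ([seeking_attractive]).  Near
    the equilibrium the energy is comparable to the squared distance to the
    equilibrium ([energy_le_norm], [energy_lt_norm_lt]), which turns decrease
    into stability and convergence.

    The derivative of [P] is never taken.  The convexity of [Phi] and the strong
    monotonicity of [P] between [x] and [x - h r] bound the difference
    quotients of the potential directly ([huber_potential_step]), and a
    continuous function whose upper right Dini derivative is nonpositive is
    nonincreasing ([dini_nonincreasing]).  Solutions exist for all initial
    states because the vector field is globally Lipschitz: Picard iterates
    converge geometrically in an exponentially weighted norm
    ([lipschitz_ode_exists]). *)

(** * Dini derivatives, geometric limits and primitives *)

Lemma within_continuous_itv_lt (R : realType) (a b : R) (g : R -> R) (s e : R) :
  {within `[a, b], continuous g} -> a <= s <= b -> 0 < e ->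
  exists2 d : R, 0 < d &
    forall t, a <= t <= b -> `|s - t| < d -> `|g s - g t| < e.
Proof.
move=> /subspace_continuousP gc sab e0.
have /cvgrPdist_lt/(_ _ e0) := gc s ltac:(by rewrite /= in_itv).
rewrite near_withinE => /nbhs_ballP[d /= d0 dP]; exists d => // t tab st.
by apply: dP => //=; rewrite in_itv.
Qed.

(** Tilting [phi] by [eps (t - a)], the supremum of the points below a level
    strictly between the end values would be followed by further such points.
    The Dini condition bears on interior points because solutions starting at
    time [0] have a derivative at positive times only. *)
Lemma dini_nonincreasing (R : realType) (phi : R -> R) (a b : R) :
  a <= b -> {within `[a, b], continuous phi} ->
  (forall t, a < t < b -> forall eps : R, 0 < eps ->
     \forall h \near 0^'+, phi (t + h) <= phi t + eps * h) ->
  phi b <= phi a.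
Proof.
move=> leab phic phiD; rewrite leNgt; apply/negP => ltphi.
have ltab : a < b.
  by rewrite lt_neqAle leab andbT; apply/eqP => abE; rewrite abE ltxx in ltphi.
pose eps := (phi b - phi a) / (2 * (b - a)).
have eps0 : 0 < eps by rewrite divr_gt0 ?subr_gt0// mulr_gt0 ?subr_gt0.
pose psi t := phi t - eps * (t - a).
have psia : psi a = phi a by rewrite /psi subrr mulr0 subr0.
have psib : psi b = (phi a + phi b) / 2.
  by rewrite /psi /eps; field; rewrite subr_eq0 gt_eqF.
have psic (s e : R) : a <= s <= b -> 0 < e -> exists2 d : R, 0 < d &
    forall t, a <= t <= b -> `|s - t| < d -> `|psi s - psi t| < e.
  move=> sab e0; apply: within_continuous_itv_lt => //.
  apply: within_continuousB; first exact: phic.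
  apply: continuous_subspaceT => x.
  by apply: cvgM; [exact: cvg_cst|apply: cvgB => //; exact: cvg_cst].
pose eta := (psi a + psi b) / 2.
have [aeta etab] : psi a < eta /\ eta < psi b.
  by rewrite /eta psib psia; split; lra.
pose S := [set t | a <= t <= b /\ psi t <= eta].
have Sa : S a by split; [rewrite lexx|exact: ltW].
have Sub : ubound S b by move=> t [/andP[]].
have hS : has_sup S by split; [exists a|exists b].
pose s := sup S.
have [as_ sb] : a <= s /\ s <= b.
  by split; [apply: ub_le_sup => //; exists b|apply: ge_sup => //; exists a].
have sab : a <= s <= b by rewrite as_.
have psis : psi s <= eta.
  rewrite leNgt; apply/negP => etas.
  have [d d0 dP] := psic s (psi s - eta) sab ltac:(by rewrite subr_gt0).
  have [t St st] := sup_adherent d0 hS.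
  have ts : t <= s by apply: ub_le_sup => //; exists b.
  have := dP t St.1; rewrite ger0_norm ?subr_ge0//.
  move=> /(_ ltac:(rewrite -/s in st; lra)).
  by case: St => _ pt /ltr_normlP[_]; lra.
have {}sb : s < b.
  rewrite lt_neqAle sb andbT; apply/eqP => sbE.
  by move: psis; rewrite sbE leNgt etab.
have as' : a < s.
  have [d d0 dP] := psic a (eta - psi a) ltac:(by rewrite lexx)
    ltac:(by rewrite subr_gt0).
  pose t := a + Num.min (d / 2) (b - a).
  have [t1 t2 t3] : [/\ a < t, t <= b & t - a < d].
    rewrite /t; case: (leP (d / 2) (b - a)) => ?; split; lra.
  apply: (lt_le_trans t1); apply: ub_le_sup; first by exists b.
  split; first by rewrite (ltW t1).
  have := dP t; rewrite (ltW t1) t2 distrC gtr0_norm ?subr_gt0// => /(_ isT t3).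
  by move=> /ltr_normlP[]; lra.
have := phiD s; rewrite as' sb => /(_ isT _ eps0) phis.
near (0 : R)^'+ => h.
have h0 : 0 < h by [].
have hb : h < b - s by near: h; apply: nbhs_right_lt; rewrite subr_gt0.
have Ssh : S (s + h).
  split; first by apply/andP; split; lra.
  have : phi (s + h) <= phi s + eps * h by near: h.
  by move: psis; rewrite /psi; nra.
have : s + h <= s by apply: ub_le_sup => //; exists b.
lra.
Unshelve. all: by end_near. Qed.

(** With [B = C / (1 - q)], the intervals [v n - B q^n, v n + B q^n] are nested:
    the limit is the supremum of their lower ends. *)
Lemma geometric_limit (R : realType) (v : nat -> R) (C q : R) :
  0 <= q < 1 -> (forall n, `|v n.+1 - v n| <= C * q ^+ n) ->
  exists l, forall n, `|v n - l| <= C / (1 - q) * q ^+ n.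
Proof.
move=> /andP[q0 q1] vq; pose B := C / (1 - q).
have BE : B * (1 - q) = C by rewrite /B divfK// subr_eq0 gt_eqF.
pose lo n := v n - B * q ^+ n; pose hi n := v n + B * q ^+ n.
have C0 : 0 <= C by have := vq 0; rewrite expr0 mulr1; apply: le_trans.
have B0 n : 0 <= B * q ^+ n.
  by rewrite mulr_ge0 ?exprn_ge0// divr_ge0// subr_ge0 ltW.
have loS : nondecreasing_seq lo.
  apply/nondecreasing_seqP => n; have /ler_normlP[] := vq n.
  by rewrite /lo exprS -BE; nra.
have hiS : nonincreasing_seq hi.
  apply/nonincreasing_seqP => n; have /ler_normlP[] := vq n.
  by rewrite /hi exprS -BE; nra.
have lohi n m : lo n <= hi m.
  apply: le_trans (loS _ _ (leq_maxl n m)) _.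
  apply: le_trans (hiS _ _ (leq_maxr n m)).
  by rewrite /lo /hi; have := B0 (maxn n m); lra.
exists (sup (range lo)) => n; rewrite -/B.
have h1 : lo n <= sup (range lo).
  by apply: ub_le_sup; [exists (hi 0) => _ [k _ <-]|exists n].
have h2 : sup (range lo) <= hi n.
  by apply: ge_sup; [exists (lo 0), 0|move=> _ [k _ <-]].
move: h1 h2; rewrite ler_norml /lo /hi => h1 h2.
by apply/andP; split; lra.
Qed.

(** The integral starts at [-1] so that the primitive has a two-sided derivative
    at [0] as well. *)
Lemma continuous_primitive (R : realType) (g : R -> R) :
  continuous g ->
  exists G : R -> R, G 0 = 0 /\ forall t : R, -1 < t -> is_derive t 1 G (g t).
Proof.
move=> gc; pose F (x : R) := (\int[lebesgue_measure]_(t in `[(-1)%R, x]) g t)%R.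
exists (fun x => F x - F 0); split; first by rewrite subrr.
move=> t t1.
have [||//|//|dF FE] := @continuous_FTC1_closed R g (-1) t (t + 1).
- by rewrite ltrDl.
- apply: continuous_compact_integrable; first exact: segment_compact.
  by apply: continuous_subspaceT => x; exact: gc.
- exact: gc.
have dF' : is_derive t 1 F (g t).
  by split; [exact: dF|rewrite -derive1E FE].
have -> : (fun x => F x - F 0) = F - cst (F 0) by [].
by rewrite -[g t]subr0; exact: is_deriveB.
Qed.

Lemma derive_le_mean_value (R : realType) (G psi dG dpsi : R -> R) (t : R) :
  0 <= t ->
  (forall s : R, 0 <= s -> is_derive s 1 G (dG s)) ->
  (forall s : R, 0 <= s -> is_derive s 1 psi (dpsi s)) ->
  (forall s : R, 0 <= s -> `|dG s| <= dpsi s) ->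
  `|G t - G 0| <= psi t - psi 0.
Proof.
move=> t0 GD psiD le_d.
have cont (H dH : R -> R) : (forall s : R, 0 <= s -> is_derive s 1 H (dH s)) ->
    {within `[0, t], continuous H}.
  move=> HD; apply: derivable_within_continuous => s.
  by rewrite in_itv/= => /andP[s0 _]; have [] := HD s s0.
have key (H dH : R -> R) : (forall s : R, 0 <= s -> is_derive s 1 H (dH s)) ->
    (forall s : R, 0 <= s -> 0 <= dH s) -> H 0 <= H t.
  move=> HD H0.
  have HD' s : s \in `]0, t[ -> is_derive s 1 H (dH s).
    by rewrite in_itv/= => /andP[/ltW s0 _]; exact: HD.
  have [c] := MVT_segment t0 HD' (cont _ _ HD).
  rewrite in_itv/= subr0 => /andP[c0 _] HE.
  by rewrite -subr_ge0 HE mulr_ge0// H0.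
have hadd : (psi + G) 0 <= (psi + G) t.
  apply: (key _ (fun s => dpsi s + dG s)) => s s0.
    by apply: is_deriveD; [exact: psiD|exact: GD].
  by have := le_d s s0; rewrite ler_norml => /andP[]; lra.
have hsub : (psi - G) 0 <= (psi - G) t.
  apply: (key _ (fun s => dpsi s - dG s)) => s s0.
    by apply: is_deriveB; [exact: psiD|exact: GD].
  by have := le_d s s0; rewrite ler_norml => /andP[]; lra.
move: hadd hsub; rewrite !fctE ler_norml => hadd hsub.
by apply/andP; split; lra.
Qed.
Lemma geometric_small (R : realType) (B q e : R) :
  0 <= q < 1 -> 0 < e -> exists n, B * q ^+ n < e.
Proof.
move=> /andP[q0 q1] e0.
have /cvgrPdist_lt/(_ _ e0) := @cvg_geometric R B q ltac:(by rewrite ger0_norm).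
move=> near_e; near \oo => n; exists n.
have : `|0 - geometric B q n| < e by near: n.
by rewrite /geometric/= sub0r normrN => /ltr_normlP[].
Unshelve. all: by end_near. Qed.

Lemma geometric_squeeze (R : realType) (a B q : R) :
  0 <= q < 1 -> (forall n, `|a| <= B * q ^+ n) -> a = 0.
Proof.
move=> q01 aB; apply/eqP; rewrite -normr_le0 leNgt; apply/negP => a0.
have [n] := geometric_small B q01 a0.
by rewrite ltNge aB.
Qed.

(** * Global solutions of Lipschitz differential equations *)

Section Picard.
Variables (R : realType) (I : finType) (F : (I -> R) -> I -> R) (K : R).
Hypothesis K_gt0 : 0 < K.
Hypothesis F_lip : forall z w (d : R), (forall j, `|z j - w j| <= d) ->
  forall i, `|F z i - F w i| <= K * d.

(* Precomposing with [clamp] turns continuity on nonnegative times into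
   continuity on the whole line, where primitives are available. *)
Let clamp (s : R) := Num.max s 0.

Let clampE (s : R) : 0 <= s -> clamp s = s.
Proof. by move=> s0; rewrite /clamp; apply/max_idPl. Qed.

Let clamp_ge0 s : 0 <= clamp s.
Proof. by rewrite /clamp le_max lexx orbT. Qed.

Let clamp_continuous : continuous clamp.
Proof. by move=> s; apply: continuous_max; [exact: cvg_id|exact: cvg_cst]. Qed.

Let curve_continuous (w : R -> I -> R) :=
  forall i, continuous (fun s => w (clamp s) i).

Let F_continuous w : curve_continuous w ->
  forall i, continuous (fun s => F (w (clamp s)) i).
Proof.
move=> wc i s; apply/cvgrPdist_le => /= e e0.
have eK : 0 < e / K by rewrite divr_gt0.
near=> t.
rewrite (_ : e = K * (e / K)); last by rewrite mulrC divfK// gt_eqF.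
apply: F_lip; near: t; apply: filter_forall => j.
by have /cvgrPdist_le/(_ _ eK) := wc j s.
Unshelve. all: by end_near. Qed.

(** The Picard operator [T] halves the distance between curves measured by the
    supremum of [|w s - w' s| exp (- 2 K s)] over all nonnegative times, so its
    iterates converge for all times at once. *)
Lemma lipschitz_ode_exists (z0 : I -> R) :
  exists u : R -> I -> R, u 0 = z0 /\
    forall (t : R) i, 0 <= t -> is_derive t 1 (u^~ i) (F (u t) i).
Proof.
have [prim primP] : exists prim : (R -> R) -> R -> R, forall g, continuous g ->
    prim g 0 = 0 /\ forall t : R, -1 < t -> is_derive t 1 (prim g) (g t).
  suff : forall g : R -> R, exists G : R -> R, continuous g ->
      G 0 = 0 /\ forall t : R, -1 < t -> is_derive t 1 G (g t).
    by move=> /(@choice _ _ _)[prim primP]; exists prim.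
  move=> g; have [gc|gc] := pselect (continuous g); last by exists g.
  by have [G GP] := continuous_primitive gc; exists G.
pose T (w : R -> I -> R) (t : R) i :=
  z0 i + prim (fun s => F (w (clamp s)) i) t.
have T0 w i : curve_continuous w -> T w 0 i = z0 i.
  by move=> wc; rewrite /T (primP _ (F_continuous wc (i := i))).1 addr0.
have TD w (t : R) i : curve_continuous w -> 0 <= t ->
    is_derive t 1 ((T w)^~ i) (F (w t) i).
  move=> wc t0; rewrite -{2}(clampE t0) -[F _ i]add0r.
  have t1 : -1 < t by rewrite (lt_le_trans _ t0)// oppr_lt0.
  have D := (primP _ (F_continuous wc (i := i))).2 t t1.
  by apply: is_deriveD.
have Tc w : curve_continuous w -> curve_continuous (T w).
  move=> wc i s.
  have /derivable1_diffP/differentiable_continuous Tc :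
      derivable ((T w)^~ i) (clamp s) 1 by have [] := TD w _ i wc (clamp_ge0 s).
  apply: (@continuous_comp _ _ _ clamp ((T w)^~ i)) => //.
  exact: clamp_continuous.
pose lam := 2 * K.
pose E (t : R) : R := expR (lam * t).
have E0 t : 0 < E t by exact: expR_gt0.
have ED (B t : R) : is_derive t 1 (fun s => B * E s) (B * lam * E t).
  have D1 : is_derive t 1 (fun s : R => lam * s) lam.
    by rewrite -[X in is_derive _ _ _ X]mulr1; exact: is_deriveZ.
  have D2 : is_derive t 1 E (lam * E t).
    by rewrite mulrC; exact: (@is_derive1_comp R expR (fun s : R => lam * s)).
  by rewrite -mulrA; exact: is_deriveZ.
have grow (dw : R -> R) (G : R -> R) (B t : R) : 0 <= t -> G 0 = 0 ->
    (forall s : R, 0 <= s -> is_derive s 1 G (dw s)) ->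
    (forall s : R, 0 <= s -> `|dw s| <= B * lam * E s) ->
    `|G t| <= B * E t.
  move=> t0 G0 GD le_dw.
  have B0 : 0 <= B.
    have := le_trans (normr_ge0 _) (le_dw 0 (lexx 0)).
    by rewrite pmulr_lge0// pmulr_lge0// mulr_gt0.
  have := derive_le_mean_value t0 GD (fun s _ => ED B s) le_dw.
  rewrite G0 subr0 => /le_trans; apply.
  by rewrite lerBlDr lerDl mulr_ge0// ltW.
have contract w w' B t i : curve_continuous w -> curve_continuous w' ->
    (forall (s : R) j, 0 <= s -> `|w s j - w' s j| <= B * E s) -> 0 <= t ->
    `|T w t i - T w' t i| <= B / 2 * E t.
  move=> wc wc' le_w t0.
  apply: (grow (fun s => F (w s) i - F (w' s) i)
               (fun s => T w s i - T w' s i)) => // [|s s0|s s0].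
  - by rewrite !T0// subrr.
  - by apply: is_deriveB; exact: TD.
  - have -> : B / 2 * lam * E s = K * (B * E s) by rewrite /lam; field.
    by apply: F_lip => j; exact: le_w.
pose w n := iter n T (fun=> z0).
have wc n : curve_continuous (w n).
  by elim: n => [|n ih]; [move=> i s; exact: cvg_cst|exact: Tc].
pose C := (\sum_i `|F z0 i|) / lam.
have lam0 : 0 < lam by rewrite /lam mulr_gt0.
have C0 : 0 <= C by rewrite divr_ge0 ?sumr_ge0// ltW.
have w_step n : forall (t : R) i, 0 <= t ->
    `|w n.+1 t i - w n t i| <= C * E t * (1 / 2) ^+ n.
  elim: n => [|n ih] t i t0.
    rewrite expr0 mulr1 /=; apply: (grow (fun=> F z0 i)
      (fun s => T (fun=> z0) s i - z0 i)) => // [|s s0|s s0].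
    - by rewrite T0 ?subrr//; exact: (wc 0).
    - by rewrite -[F z0 i]subr0; apply: is_deriveB; exact: (TD _ _ _ (wc 0)).
    - rewrite /C divfK ?gt_eqF//.
      apply: (@le_trans _ _ (\sum_i `|F z0 i|)).
        by rewrite (bigD1 i)//= lerDl sumr_ge0.
      by rewrite ler_peMr ?sumr_ge0// /E -expR0 ler_expR mulr_ge0// ltW.
  rewrite exprS mulrA (_ : C * E t * (1 / 2) * _ = C * (1 / 2) ^+ n / 2 * E t);
    last by field.
  apply: (contract (w n.+1) (w n)) => // s j s0.
  by rewrite mulrAC; exact: ih.
have [v vP] : exists v : R -> I -> R, forall (t : R) i, 0 <= t ->
    forall n, `|w n t i - v t i| <= 2 * C * E t * (1 / 2) ^+ n.
  suff : forall t : R, exists vt : I -> R, forall i, 0 <= t ->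
      forall n, `|w n t i - vt i| <= 2 * C * E t * (1 / 2) ^+ n.
    by move=> /(@choice _ _ _)[v vP]; exists v => t i; exact: vP.
  move=> t.
  suff : forall i, exists l : R, 0 <= t ->
      forall n, `|w n t i - l| <= 2 * C * E t * (1 / 2) ^+ n.
    by move=> /(@choice _ _ _)[vt vtP]; exists vt => i; exact: vtP.
  move=> i; have [t0|_] := leP 0 t; last by exists 0.
  have [l lP] := @geometric_limit R (fun n => w n t i) (C * E t) (1 / 2)
    ltac:(lra) (fun n => w_step n t i t0).
  exists l => _ n; apply: le_trans (lP n) _.
  by rewrite (_ : C * E t / (1 - 1 / 2) = 2 * C * E t)//; field.
have vc : curve_continuous v.
  move=> i s; apply/cvgrPdist_le => /= e e0.
  have [n nP] := @geometric_small R (2 * C * E (clamp s + 1)) (1 / 2) (e / 3)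
    ltac:(lra) ltac:(lra).
  have e3 : 0 < e / 3 by lra.
  have /cvgrPdist_le/(_ _ e3) wcn := wc n i s.
  have near1 : \forall t \near s, `|clamp s - clamp t| <= 1.
    by move/cvgrPdist_le: (@clamp_continuous s); apply.
  near=> t.
  have tail (r : R) : 0 <= r -> r <= clamp s + 1 -> `|w n r i - v r i| <= e / 3.
    move=> r0 rs; apply: le_trans (vP r i r0 n) _.
    apply: le_trans (ltW nP); apply: ler_wpM2r; first by rewrite exprn_ge0.
    apply: ler_wpM2l; first by rewrite mulr_ge0.
    by rewrite /E ler_expR ler_wpM2l// ltW.
  have ts : clamp t <= clamp s + 1.
    have : `|clamp s - clamp t| <= 1 by near: t.
    by rewrite ler_norml => /andP[]; lra.
  have h1 := tail _ (clamp_ge0 t) ts.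
  have h2 := tail (clamp s) (clamp_ge0 s) ltac:(lra).
  have h3 : `|w n (clamp s) i - w n (clamp t) i| <= e / 3 by near: t.
  move: h1 h2 h3; rewrite !ler_norml => /andP[? ?] /andP[? ?] /andP[? ?].
  by apply/andP; split; lra.
have Tv (t : R) i : 0 <= t -> T v t i = v t i.
  move=> t0; apply/eqP; rewrite -subr_eq0; apply/eqP.
  apply: (@geometric_squeeze R _ (2 * C * E t) (1 / 2)) => [|n]; first by lra.
  have h1 := vP t i t0 n.+1.
  have h2 : `|T (w n) t i - T v t i| <= 2 * C * (1 / 2) ^+ n / 2 * E t.
    apply: (contract (w n) v) => // s j s0.
    by rewrite mulrAC; exact: vP.
  have -> : T v t i - v t i = (w n.+1 t i - v t i) - (T (w n) t i - T v t i).
    by rewrite [w n.+1]/=; ring.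
  apply: le_trans (ler_normB _ _) _; apply: le_trans (lerD h1 h2) _.
  by rewrite exprS le_eqVlt; apply/orP; left; apply/eqP; field.
(* [v] is a fixed point of [T]; [T v] is used because it is differentiable by
   construction. *)
exists (T v); split; first by apply/funext => i; rewrite T0.
move=> t i t0; rewrite (_ : T v t = v t); first exact: TD.
by apply/funext => j; rewrite Tv.
Unshelve. all: by end_near. Qed.

End Picard.

(** * Lipschitz bounds from second derivatives *)

Lemma sqr_sum_le (R : realFieldType) (I : finType) (a : I -> R) :
  (\sum_i a i) ^+ 2 <= #|I|%:R * \sum_i a i ^+ 2.
Proof.
have -> : (\sum_i a i) ^+ 2 = \sum_i \sum_j a i * a j.
  by rewrite expr2 mulr_suml; apply: eq_bigr => i _; rewrite mulr_sumr.
have -> : #|I|%:R * (\sum_i a i ^+ 2) =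
    \sum_i \sum_j (a i ^+ 2 + a j ^+ 2) / 2 :> R.
  under [RHS]eq_bigr do rewrite -mulr_suml big_split/= sumr_const.
  rewrite -mulr_suml big_split/= sumr_const sumrMnl.
  by rewrite -mulr2n -[X in X / 2]mulr_natr mulfK ?pnatr_eq0// mulr_natl.
apply: ler_sum => i _; apply: ler_sum => j _.
by have := sqr_ge0 (a i - a j); nra.
Qed.

Lemma is_derive_line (R : realType) (V : normedModType R) (g : V -> R)
    (x v : V) (t : R) :
  derivable g (x + t *: v) v ->
  is_derive t 1 (fun s : R => g (x + s *: v)) ('D_v g (x + t *: v)).
Proof.
have E : (fun h : R => h^-1 *: (g (x + (h *: 1 + t) *: v) - g (x + t *: v))) =
  (fun h : R => h^-1 *: (g (h *: v + (x + t *: v)) - g (x + t *: v))).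
  by apply/funext => h; rewrite [h *: 1]mulr1 scalerDl addrCA.
move=> gd; split; first by rewrite /derivable E.
by rewrite /derive E.
Qed.

(** The condition [0 <= c * t] says that the intermediate point lies on the
    same side as [t]; this form covers both signs of [t]. *)
Lemma line_mean_value (R : realType) (V : normedModType R) (g : V -> R)
    (x v : V) (t : R) :
  (forall y, derivable g y v) ->
  exists2 c, 0 <= c * t & g (x + t *: v) - g x = t * 'D_v g (x + c *: v).
Proof.
move=> gd; pose phi s := g (x + s *: v).
have phiD (s : R) : is_derive s 1 phi ('D_v g (x + s *: v)).
  exact: is_derive_line.
have phic (A : set R) : {within A, continuous phi}.
  apply: continuous_subspaceT => s.
  by apply/differentiable_continuous/derivable1_diffP; have [] := phiD s.
have phi0 : phi 0 = g x by rewrite /phi scale0r addr0.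
have [t0|t0] := leP 0 t.
  have [c] := MVT_segment t0 (fun s _ => phiD s) (phic _).
  rewrite in_itv/= => /andP[c0 _] E; exists c; first by rewrite mulr_ge0.
  by rewrite -phi0 -/(phi t) E subr0 mulrC.
have [c] := MVT_segment (ltW t0) (fun s _ => phiD s) (phic _).
rewrite in_itv/= => /andP[_ c0] E; exists c; first by rewrite mulr_le0// ltW.
by apply: oppr_inj; rewrite -phi0 -/(phi t) opprB E; ring.
Qed.

Lemma line_lipschitz (R : realType) (V : normedModType R) (g : V -> R)
    (x v : V) (M t : R) :
  (forall y, derivable g y v) -> (forall y, `|'D_v g y| <= M) ->
  `|g (x + t *: v) - g x| <= M * `|t|.
Proof.
move=> gd gM; have [c _ ->] := line_mean_value x t gd.
by rewrite normrM mulrC ler_wpM2r.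
Qed.

(** The mixed difference of [g] over a parallelogram with sides [s v] and [t w]
    is at most [M |s t|], by two applications of the mean value theorem, first
    along [w] and then along [v].  Dividing by [s] and letting [s] tend to [0]
    bounds increments of [D_v g] along [w].  The mean value theorem applied in
    this order is what calls for a bound on [D_v (D_w g)]. *)
Lemma mixed_derive_lipschitz (R : realType) (V : normedModType R) (g : V -> R)
    (x v w : V) (M t : R) :
  (forall y, derivable g y v) -> (forall y, derivable g y w) ->
  (forall y, derivable ('D_w g) y v) -> (forall y, `|'D_v ('D_w g) y| <= M) ->
  `|'D_v g (x + t *: w) - 'D_v g x| <= M * `|t|.
Proof.
move=> gv gw gwv gM.
pose dq y (s : R) := s^-1 *: (g (s *: v + y) - g y).
have dqP y : dq y s @[s --> 0^'] --> 'D_v g y by exact: gv.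
have cvg_diff : `|dq (x + t *: w) s - dq x s| @[s --> 0^'] -->
    `|'D_v g (x + t *: w) - 'D_v g x|.
  by apply: cvg_norm; apply: cvgB.
apply: (cvgr_to_le cvg_diff).
near=> s.
have s0 : s != 0 by near: s; exact: nbhs_dnbhs_neq.
pose G y := g (y + s *: v) - g y.
have Gd y : is_derive y w G ('D_w g (y + s *: v) - 'D_w g y).
  apply: is_deriveB; last exact: derivableP.
  have E : (fun h : R => h^-1 *: (g (h *: w + y + s *: v) - g (y + s *: v))) =
    (fun h : R => h^-1 *: (g (h *: w + (y + s *: v)) - g (y + s *: v))).
    by apply/funext => h; rewrite addrA.
  split; first by rewrite /derivable E; exact: gw.
  by rewrite /derive E.
have GM y : `|'D_w G y| <= M * `|s|.
  by have [_ ->] := Gd y; exact: (@line_lipschitz _ _ ('D_w g) y v M s gwv gM).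
have Gdw y : derivable G y w by have [] := Gd y.
have := line_lipschitz x t Gdw GM.
have -> : dq (x + t *: w) s - dq x s = s^-1 * (G (x + t *: w) - G x).
  by rewrite /dq /G -scalerBr [_ + s *: v]addrC [x + s *: v]addrC.
rewrite normrM normfV ler_pdivrMl ?normr_gt0// => /le_trans; apply.
by rewrite le_eqVlt; apply/orP; left; apply/eqP; ring.
Unshelve. all: by end_near. Qed.

(** Replace the coordinates of [z] by those of [x] one at a time. *)
Lemma coordinate_lipschitz (R : realType) (N : nat) (g : 'rV[R]_N -> R)
    (M : R) :
  (forall x (j : 'I_N) (t : R),
     `|g (x + t *: delta_mx 0 j) - g x| <= M * `|t|) ->
  forall x z, `|g x - g z| <= M * \sum_j `|x 0 j - z 0 j|.
Proof.
move=> gM x z.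
pose w k : 'rV[R]_N := \row_(j < N) if (j < k)%N then x 0 j else z 0 j.
have wS (k : 'I_N) : w k.+1 = w k + (x 0 k - z 0 k) *: delta_mx 0 k.
  apply/rowP => j; rewrite !mxE eqxx/= ltnS.
  have [->|jk] := eqVneq j k; first by rewrite leqnn ltnn mulr1 subrKC.
  by rewrite mulr0 addr0 leq_eqVlt (negbTE (jk : val j != val k)).
have w0 : w 0 = z by apply/rowP => j; rewrite mxE.
have wN : w N = x by apply/rowP => j; rewrite mxE ltn_ord.
have telescope_w k : (k <= N)%N ->
    `|g (w k) - g z| <= M * \sum_(j < N | (j < k)%N) `|x 0 j - z 0 j|.
  elim: k => [_|k ih kN].
    by rewrite w0 subrr normr0 big_pred0 ?mulr0.
  pose k' := Ordinal kN.
  rewrite (bigD1 k')//= (eq_bigl (fun j : 'I_N => (j < k)%N)); last first.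
    by move=> j; rewrite ltnS -val_eqE/= andbC ltn_neqAle.
  rewrite mulrDr -[g (w k.+1)](subrK (g (w k))) -addrA.
  apply: le_trans (ler_normD _ _) _; apply: lerD; last exact/ih/ltnW.
  by rewrite (wS k') gM.
have := telescope_w N (leqnn N); rewrite wN => /le_trans; apply.
by rewrite (eq_bigl xpredT)// => j; rewrite ltn_ord.
Qed.

(** * Nash equilibria as zeros of a strongly monotone map *)

Lemma deviateE (R : realType) (N : nat) (x : 'rV[R]_N) (i : 'I_N) (t : R) :
  deviate x i t = x + (t - x 0 i) *: delta_mx 0 i.
Proof.
apply/rowP => j; rewrite !mxE eqxx/=.
by have [->|_] := eqVneq j i; rewrite ?mulr1 ?subrKC// mulr0 addr0.
Qed.

(** Monotonicity of the pseudo-gradient along the [i]-th axis makes the [i]-th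
    cost convex in the action of player [i], so a critical point of that
    partial function is a global minimum. *)
Lemma nash_equilibriumP (R : realType) (N : nat) (f : 'I_N -> 'rV[R]_N -> R)
    (x : 'rV[R]_N) :
  (forall i y, derivable (f i) y (delta_mx 0 i)) ->
  (forall y z, 0 <= dotp (y - z) (pseudo_gradient f y - pseudo_gradient f z)) ->
  nash_equilibrium f x <-> pseudo_gradient f x = 0.
Proof.
move=> fd mono; split => [ne|P0 i t].
  apply/rowP => i; rewrite !mxE.
  pose phi (s : R) := f i (x + s *: delta_mx 0 i).
  have phiD (s : R) :
      is_derive s 1 phi (partial i (f i) (x + s *: delta_mx 0 i)).
    exact/is_derive_line/fd.
  have : is_derive (0 : R) 1 phi 0.
    apply: (@derive1_at_min _ phi (-1) 1) => [|s _||s _]; first by lra.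
    - by have [] := phiD s.
    - by rewrite in_itv/=; apply/andP; split; lra.
    - have := ne i (x 0 i + s); rewrite deviateE addrAC subrr add0r.
      by rewrite /phi scale0r addr0.
  have [_ E0] := phiD 0 => -[_]; rewrite E0 scale0r addr0.
  by [].
rewrite deviateE -subr_ge0; set s := t - _.
have [c cs ->] := line_mean_value x s (fd i).
have [c0|c0] := eqVneq c 0.
  rewrite c0 scale0r addr0; have := congr1 (fun v : 'rV_N => v 0 i) P0.
  by rewrite !mxE => E; rewrite -[in _ * _]/(partial i (f i) x) E mulr0.
have := mono (x + c *: delta_mx 0 i) x.
rewrite P0 subr0 addrAC subrr add0r /dotp (bigD1 i)//= big1 ?addr0; last first.
  by move=> j ji; rewrite !mxE eqxx/= (negbTE ji) mulr0 mul0r.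
rewrite !mxE !eqxx mulr1 -[X in _ * X]/('D_(delta_mx 0 i) (f i) _) => cD.
have c2 : 0 < c ^+ 2 by rewrite exprn_even_gt0.
by rewrite -(pmulr_rge0 _ c2); nra.
Qed.

Lemma dotp_subZ (R : realType) (N : nat) (u v : 'rV[R]_N) (c : R) :
  dotp (u - c *: v) (u - c *: v) =
  dotp u u - 2 * c * dotp u v + c ^+ 2 * dotp v v.
Proof.
rewrite /dotp !mulr_sumr -sumrB -big_split/=.
by apply: eq_bigr => i _; rewrite !mxE; ring.
Qed.

Lemma sqr_le_dotp (R : realType) (N : nat) (u : 'rV[R]_N) i :
  u 0 i ^+ 2 <= dotp u u.
Proof.
rewrite /dotp (bigD1 i)//= expr2 lerDl sumr_ge0// => j _.
by rewrite -expr2 sqr_ge0.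
Qed.

Lemma dotp_ge0 (R : realType) (N : nat) (u : 'rV[R]_N) : 0 <= dotp u u.
Proof. by apply: sumr_ge0 => i _; rewrite -expr2 sqr_ge0. Qed.

Lemma dotp_eq0 (R : realType) (N : nat) (u : 'rV[R]_N) : dotp u u <= 0 -> u = 0.
Proof.
move=> u0; apply/rowP => i; rewrite mxE; apply/eqP; rewrite -sqrf_eq0 eq_le.
by rewrite sqr_ge0 andbT (le_trans (sqr_le_dotp u i)).
Qed.

Lemma sum_norm_sqr_le (R : realType) (N : nat) (u : 'rV[R]_N) :
  (\sum_j `|u 0 j|) ^+ 2 <= N%:R * dotp u u.
Proof.
apply: le_trans (sqr_sum_le _) _; rewrite card_ord /dotp ler_wpM2l//.
by apply: ler_sum => i _; rewrite -normrX ger0_norm ?sqr_ge0// expr2.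
Qed.

(** [x - gam P x] contracts squared Euclidean distances by the factor
    [1 - 2 gam m + gam^2 B], where [B] bounds the squared Lipschitz constant of
    [P]. *)
Lemma strongly_monotone_zero (R : realType) (N : nat)
    (P : 'rV[R]_N -> 'rV[R]_N) (m L : R) :
  0 < m -> 0 <= L ->
  (forall x z, m * dotp (x - z) (x - z) <= dotp (x - z) (P x - P z)) ->
  (forall x z i, `|P x 0 i - P z 0 i| <= L * \sum_j `|x 0 j - z 0 j|) ->
  exists x, P x = 0.
Proof.
move=> m0 L0 mono lip.
pose B := N%:R ^+ 2 * L ^+ 2.
have B0 : 0 <= B by rewrite mulr_ge0 ?sqr_ge0// exprn_ge0.
have lip2 x z : dotp (P x - P z) (P x - P z) <= B * dotp (x - z) (x - z).
  apply: (@le_trans _ _ (\sum_(i < N) L ^+ 2 * (N%:R * dotp (x - z) (x - z)))).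
    apply: ler_sum => i _; rewrite !mxE -expr2.
    rewrite -real_normK ?num_real//.
    apply: (@le_trans _ _ (L ^+ 2 * (\sum_j `|(x - z) 0 j|) ^+ 2)).
      rewrite -exprMn ler_sqr ?nnegrE//; last first.
        by rewrite mulr_ge0// sumr_ge0.
      apply: le_trans (lip x z i) _; rewrite ler_wpM2l// ler_sum// => j _.
      by rewrite !mxE.
    by rewrite ler_wpM2l ?sqr_ge0// sum_norm_sqr_le.
  rewrite sumr_const card_ord -mulr_natl /B.
  by rewrite le_eqVlt; apply/orP; left; apply/eqP; ring.
(* The optimal step would be [m / B]; adding [m ^+ 2] keeps the denominator
   positive and the contraction factor [q] nonnegative. *)
pose gam := m / (B + m ^+ 2).
have Bm0 : 0 < B + m ^+ 2 by rewrite ltr_wpDl// exprn_gt0.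
have gam0 : 0 < gam by rewrite divr_gt0.
pose q := 1 - m ^+ 2 / (B + m ^+ 2).
have q0 : 0 <= q by rewrite subr_ge0 ler_pdivrMr// mul1r lerDr.
have q1 : q < 1 by rewrite gtrDl oppr_lt0 divr_gt0// exprn_gt0.
pose T x := x - gam *: P x.
have T_contract x z : dotp (T x - T z) (T x - T z) <= q * dotp (x - z) (x - z).
  have -> : T x - T z = (x - z) - gam *: (P x - P z).
    by apply/rowP => i; rewrite /T !mxE; ring.
  rewrite dotp_subZ.
  have := mono x z; have := lip2 x z; have := dotp_ge0 (x - z).
  set d := dotp (x - z) _; set e := dotp (x - z) (P x - P z).
  set h := dotp (P x - P z) (P x - P z).
  move=> d0 hd ed.
  apply: (@le_trans _ _
    (d - 2 * gam * (m * d) + gam ^+ 2 * ((B + m ^+ 2) * d))).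
    apply: lerD; first by rewrite lerD2l lerN2 ler_wpM2l// mulr_ge0// ltW.
    rewrite ler_wpM2l ?sqr_ge0//; apply: le_trans hd _.
    by rewrite ler_wpM2r// lerDl sqr_ge0.
  rewrite le_eqVlt; apply/orP; left; apply/eqP; rewrite /gam /q.
  by field; rewrite gt_eqF.
pose v n := iter n T 0.
pose c := dotp (v 1%N - v 0%N) (v 1%N - v 0%N).
have v_step n : dotp (v n.+1 - v n) (v n.+1 - v n) <= c * q ^+ n.
  elim: n => [|n ih]; first by rewrite expr0 mulr1.
  rewrite exprS mulrCA; apply: le_trans (T_contract (v n.+1) (v n)) _.
  by rewrite ler_wpM2l.
have c0 : 0 <= c by exact: dotp_ge0.
pose r := Num.sqrt q.
have r01 : 0 <= r < 1.
  by rewrite sqrtr_ge0/= -sqrtr1 ltr_sqrt.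
have v_step1 i n : `|v n.+1 0 i - v n 0 i| <= Num.sqrt c * r ^+ n.
  rewrite -(@ler_pXn2r _ 2) ?nnegrE ?mulr_ge0 ?exprn_ge0 ?sqrtr_ge0//.
  rewrite exprMn exprAC !sqr_sqrtr// real_normK ?num_real//.
  have := le_trans (sqr_le_dotp (v n.+1 - v n) i) (v_step n).
  by rewrite !mxE.
have [l lP] : exists l : 'I_N -> R, forall i n,
    `|v n 0 i - l i| <= Num.sqrt c / (1 - r) * r ^+ n.
  suff : forall i, exists l : R, forall n,
      `|v n 0 i - l| <= Num.sqrt c / (1 - r) * r ^+ n.
    by move=> /(@choice _ _ _)[l lP]; exists l.
  by move=> i; exact: (geometric_limit r01 (v_step1 i)).
exists (\row_i l i); apply/rowP => i; rewrite mxE.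
pose D := Num.sqrt c / (1 - r).
(* [P (v n)] is [gam^-1] times a step of the iteration, hence tends to [0]. *)
apply: (@geometric_squeeze R _
  (L * (N%:R * D) + gam^-1 * Num.sqrt c) r) => // n.
have h1 : `|P (\row_i l i) 0 i - P (v n) 0 i| <= L * (N%:R * D) * r ^+ n.
  apply: le_trans (lip _ _ _) _; rewrite -!mulrA ler_wpM2l//.
  rewrite -[N in N%:R]card_ord -sum1_card natr_sum mulr_suml.
  by apply: ler_sum => j _; rewrite mxE mul1r distrC mulrA lP.
have h2 : `|P (v n) 0 i| <= gam^-1 * Num.sqrt c * r ^+ n.
  have -> : P (v n) 0 i = gam^-1 * (v n 0 i - v n.+1 0 i).
    by rewrite /= /T !mxE opprB addrC subrK mulKf ?gt_eqF.
  rewrite normrM gtr0_norm ?invr_gt0// -mulrA distrC.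
  by apply: ler_wpM2l; [rewrite invr_ge0 ltW|exact: v_step1].
rewrite mulrDl; apply: le_trans (lerD h1 h2).
by apply: le_trans (ler_normD _ _); rewrite subrK.
Qed.

(** * Saturation and its primitive, the Huber function *)

Section Saturation.
Variables (R : realType) (U : R).
Hypothesis U_gt0 : 0 < U.

Variant saturation_spec (p : R) : R -> Prop :=
  | SaturationId of - U <= p <= U : saturation_spec p p
  | SaturationAbove of U < p : saturation_spec p U
  | SaturationBelow of p < - U : saturation_spec p (- U).

Lemma saturationP p : saturation_spec p (saturation U p).
Proof.
rewrite /saturation; have [pU|Up] := leP `|p| U.
  by rewrite -numEsg; constructor; rewrite -ler_norml.
move: Up; have [p0|p0] := leP 0 p.
  rewrite ger0_norm// => Up; rewrite gtr0_sg ?mul1r; last exact: lt_trans Up.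
  exact: SaturationAbove.
rewrite ltr0_norm// => Up; rewrite ltr0_sg// mulN1r.
by have U0 := U_gt0; apply: SaturationBelow; lra.
Qed.

Lemma saturation0 : saturation U 0 = 0.
Proof. by rewrite /saturation sgr0 mul0r. Qed.

Lemma saturation_lipschitz p q :
  `|saturation U p - saturation U q| <= `|p - q|.
Proof.
have U0 := U_gt0; rewrite ler_norml.
have := ler_norm (p - q); have := ler_norm (q - p).
rewrite (distrC q p); set d := `|_| => h1 h2.
by case: (saturationP p) => [/andP[? ?]|?|?];
   case: (saturationP q) => [/andP[? ?]|?|?]; apply/andP; split; lra.
Qed.

(** The primitive of the saturation, [p^2 / 2] for [|p| <= U] and
    [U |p| - U^2 / 2] beyond; this form is also the maximum of [r p - r^2 / 2]
    over [|r| <= U], attained at [r = saturation U p]. *)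
Definition huber (p : R) : R := saturation U p * p - saturation U p ^+ 2 / 2.

(** The variational inequality of the projection onto [[-U, U]]. *)
Lemma saturation_projection p q :
  (saturation U p - saturation U q) * (q - saturation U q) <= 0.
Proof.
have pU : - U <= saturation U p <= U.
  have U0 := U_gt0.
  by case: (saturationP p) => [//|?|?]; apply/andP; split; lra.
move: (saturation U p) pU => r /andP[r1 r2].
case: (saturationP q) => [_|Uq|qU]; first by rewrite subrr mulr0.
  by rewrite mulr_le0_ge0// ?subr_le0// subr_ge0 ltW.
by rewrite mulr_ge0_le0// ?subr_ge0// subr_le0 ltW.
Qed.

(** The tangent inequality of a convex function with derivative
    [saturation U]; it replaces the chain rule in [huber_potential_step]. *)
Lemma huber_convex p q : huber p - huber q <= saturation U p * (p - q).
Proof.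
have := saturation_projection p q.
have := sqr_ge0 (saturation U p - saturation U q).
by rewrite /huber; nra.
Qed.

Lemma huber_ge0 p : 0 <= huber p.
Proof.
have U0 := U_gt0; rewrite /huber.
by case: (saturationP p) => [/andP[? ?]|?|?]; nra.
Qed.

Lemma huber_le_sqr p : huber p <= p ^+ 2 / 2.
Proof.
have U0 := U_gt0; rewrite /huber.
by case: (saturationP p) => [/andP[? ?]|?|?]; nra.
Qed.

(** [huber] grows linearly while [saturation] is bounded, so the comparison only
    holds on sublevel sets.  The constant adds up the two regimes: the ratio is
    [1 / 2] for [|p| <= U] and at most [c / U^2] beyond. *)
Lemma huber_le_saturation p c : huber p <= c ->
  huber p <= (1 / 2 + c / U ^+ 2) * saturation U p ^+ 2.
Proof.
have U2 : 0 < U ^+ 2 by rewrite exprn_gt0.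
move=> pc; have c0 : 0 <= c by exact: le_trans (huber_ge0 p) pc.
have [d d0 cE] : exists2 d, 0 <= d & c = d * U ^+ 2.
  by exists (c / U ^+ 2); [rewrite divr_ge0// ltW|rewrite divfK// gt_eqF].
move: pc; rewrite cE mulfK ?gt_eqF//.
have U0 := U_gt0; rewrite /huber.
case: (saturationP p) => [/andP[? ?]|?|?] pc; rewrite mulrDl.
- by have := mulr_ge0 d0 (sqr_ge0 p); nra.
- by nra.
- by rewrite sqrrN; nra.
Qed.

Lemma huber_small p : huber p < U ^+ 2 / 2 -> p ^+ 2 = 2 * huber p.
Proof.
have U0 := U_gt0; rewrite /huber.
by case: (saturationP p) => [/andP[? ?]|?|?] h;
  [field|exfalso; nra|exfalso; nra].
Qed.

End Saturation.

(** * Grounded Laplacian forms of a connected graph *)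

Section ConsensusForm.
Variables (R : realType) (N : nat) (e : rel 'I_N).
Hypothesis e_sym : symmetric e.
Let a := adjacency R e.

Let aE i k : a i k = (e i k)%:R.
Proof. exact: mxE. Qed.

(** The quadratic form of the graph Laplacian plus the diagonal matrix with
    entries [a i j], that is, of a Laplacian grounded at the neighbours of
    [j]. *)
Definition consensus_form (j : 'I_N) (z : 'I_N -> R) : R :=
  \sum_i z i * (\sum_k a i k * (z i - z k) + a i j * z i).

(** Symmetrizing the double sum exhibits the form as a sum of squares. *)
Lemma consensus_formE j z : consensus_form j z =
  (\sum_i \sum_k a i k * (z i - z k) ^+ 2) / 2 + \sum_i a i j * z i ^+ 2.
Proof.
have E : \sum_i \sum_k a i k * (z i * (z i - z k)) =
    \sum_i \sum_k a i k * (z k * (z k - z i)).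
  rewrite exchange_big/=; apply: eq_bigr => i _; apply: eq_bigr => k _.
  by rewrite !aE e_sym.
have -> : (\sum_i \sum_k a i k * (z i - z k) ^+ 2) / 2 =
    \sum_i \sum_k a i k * (z i * (z i - z k)).
  apply: (@mulIf _ 2); rewrite ?divfK ?pnatr_eq0// mulr_natr mulr2n {2}E.
  rewrite -big_split/=; apply: eq_bigr => i _.
  by rewrite -big_split/=; apply: eq_bigr => k _; ring.
rewrite /consensus_form -big_split/=; apply: eq_bigr => i _.
rewrite mulrDr mulr_sumr; congr (_ + _); last by ring.
by apply: eq_bigr => k _; ring.
Qed.

Let a_ge0 i k : 0 <= a i k.
Proof. by rewrite aE ler0n. Qed.

Let edge_le (j : 'I_N) z i k : e i k -> (z i - z k) ^+ 2 <= consensus_form j z.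
Proof.
move=> eik; rewrite consensus_formE.
have [<-|ik] := eqVneq i k.
  rewrite subrr expr0n/= addr_ge0 ?divr_ge0 ?sumr_ge0// => ? _.
    by rewrite sumr_ge0// => ? _; rewrite mulr_ge0 ?sqr_ge0.
  by rewrite mulr_ge0 ?sqr_ge0.
have h : 0 <= \sum_i a i j * z i ^+ 2.
  by rewrite sumr_ge0// => ? _; rewrite mulr_ge0 ?sqr_ge0.
apply: le_trans (lerD (lexx _) h); rewrite addr0 ler_pdivlMr// mulr_natr mulr2n.
have row_le i' k' : e i' k' ->
    (z i' - z k') ^+ 2 <= \sum_k a i' k * (z i' - z k) ^+ 2.
  move=> ei'k'; rewrite (bigD1 k')//= aE ei'k' mul1r lerDl sumr_ge0// => ? _.
  by rewrite mulr_ge0 ?sqr_ge0.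
rewrite (bigD1 i)//=; apply: lerD; first exact: row_le.
rewrite (bigD1 k) 1?eq_sym//=; apply: ler_wpDr.
  rewrite sumr_ge0// => ? _; rewrite sumr_ge0// => ? _.
  by rewrite mulr_ge0 ?sqr_ge0.
by rewrite -[_ ^+ 2]sqrrN opprB row_le// e_sym.
Qed.

Let anchor_le (j : 'I_N) z i : e i j -> z i ^+ 2 <= consensus_form j z.
Proof.
move=> eij; rewrite consensus_formE.
have h : 0 <= (\sum_i \sum_k a i k * (z i - z k) ^+ 2) / 2.
  rewrite divr_ge0// sumr_ge0// => ? _.
  by rewrite sumr_ge0// => ? _; rewrite mulr_ge0 ?sqr_ge0.
apply: le_trans (lerD h (lexx _)); rewrite add0r.
rewrite (bigD1 i)//= aE eij mul1r lerDl sumr_ge0// => ? _.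
by rewrite mulr_ge0 ?sqr_ge0.
Qed.

(** The form controls [z] at a neighbour of [j], which exists as there are at
    least two nodes, and the increments of [z] along edges; following paths from
    that neighbour, it controls [z] everywhere. *)
Lemma consensus_form_pos_def : (2 <= N)%N -> connected_graph e ->
  exists2 lam : R, 0 < lam &
    forall j z, lam * \sum_i z i ^+ 2 <= consensus_form j z.
Proof.
move=> N2 e_conn.
have node_le j : forall k, exists C : R,
    0 <= C /\ forall z, z k ^+ 2 <= C * consensus_form j z.
  move=> k.
  have [l lj] : exists l : 'I_N, l != j.
    have [j0|j0] := eqVneq (val j) 0%N.
      by exists (Ordinal N2); rewrite -val_eqE/= j0.
    by exists (Ordinal (ltnW N2)); rewrite -val_eqE/= eq_sym.
  have [y eyj] : exists y, e y j.
    have /connectP[[|y p]/= ] := e_conn j l.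
      by move=> _ lE; rewrite lE eqxx in lj.
    by move=> /andP[ejy _] _; exists y; rewrite e_sym.
  have [C [C0 CP]] : exists C : R,
      0 <= C /\ forall z, z y ^+ 2 <= C * consensus_form j z.
    by exists 1; split=> // z; rewrite mul1r anchor_le.
  have /connectP[p] := e_conn y k.
  elim: p y C C0 CP {eyj} => [|x p ih] y C C0 CP /=.
    by move=> _ ->; exists C.
  (* [z x ^+ 2 <= 2 * z y ^+ 2 + 2 * (z y - z x) ^+ 2] *)
  move=> /andP[eyx xp] kE; apply: (ih x (2 * C + 2)) => //; first by lra.
  move=> z; have := edge_le j z eyx; have := CP z.
  by have := sqr_ge0 (2 * z y - z x); nra.
have /(@choice _ _ _)[C CP] : forall jk : 'I_N * 'I_N, exists C : R, 0 <= C /\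
    forall z, z jk.2 ^+ 2 <= C * consensus_form jk.1 z.
  by move=> [j k]; exact: node_le.
pose S := 1 + \sum_j \sum_k C (j, k).
have S0 : 0 < S.
  rewrite ltr_pwDl// sumr_ge0// => j _.
  by rewrite sumr_ge0// => k _; exact: (CP _).1.
exists S^-1 => [|j z]; first by rewrite invr_gt0.
rewrite mulrC ler_pdivrMr// mulrC.
have Q0 : 0 <= consensus_form j z.
  rewrite consensus_formE addr_ge0 ?divr_ge0 ?sumr_ge0// => ? _.
    by rewrite sumr_ge0// => ? _; rewrite mulr_ge0 ?sqr_ge0.
  by rewrite mulr_ge0 ?sqr_ge0.
apply: (@le_trans _ _ ((\sum_k C (j, k)) * consensus_form j z)).
  by rewrite mulr_suml; apply: ler_sum => k _; exact: (CP (j, k)).2.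
rewrite ler_wpM2r//; apply: (@le_trans _ _ (\sum_j \sum_k C (j, k))).
  rewrite [leRHS](bigD1 j)//= lerDl sumr_ge0// => i _.
  by rewrite sumr_ge0// => k _; exact: (CP _).1.
by rewrite /S lerDr.
Qed.

End ConsensusForm.

(** * The Huber potential of a strongly monotone map *)

Lemma cvg_sumr (R : realType) (I : finType) (T : Type) (F : set_system T)
    (f : I -> T -> R) (l : I -> R) : Filter F ->
  (forall i, f i x @[x --> F] --> l i) ->
  \sum_i f i x @[x --> F] --> \sum_i l i.
Proof. by move=> FF fl; apply: cvg_big => //; exact: add_continuous. Qed.

Lemma right_quotient_cvg (R : realType) (g : R -> R) (t dg : R) :
  is_derive t 1 g dg -> h^-1 * (g (t + h) - g t) @[h --> 0^'+] --> dg.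
Proof.
move=> [gd gE].
have : h^-1 *: (g (h *: 1 + t) - g t) @[h --> 0^'] --> dg by rewrite -gE.
move=> /cvg_dnbhs_at_right.
have -> : (fun h => h^-1 *: (g (h *: 1 + t) - g t)) =
    (fun h : R => h^-1 * (g (t + h) - g t)).
  by apply/funext => h; rewrite [h *: 1]mulr1 [h + t]addrC.
exact.
Qed.

Section Potential.
Variables (R : realType) (N : nat) (P : 'rV[R]_N -> 'rV[R]_N) (m L U : R).
Hypothesis U_gt0 : 0 < U.
Hypothesis P_mono : forall x z,
  m * dotp (x - z) (x - z) <= dotp (x - z) (P x - P z).
Hypothesis P_lip : forall x z i,
  `|P x 0 i - P z 0 i| <= L * \sum_j `|x 0 j - z 0 j|.

Definition saturated_field (x : 'rV[R]_N) : 'rV[R]_N :=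
  \row_i saturation U (P x 0 i).

Let rho := saturated_field.

Definition huber_potential (x : 'rV[R]_N) : R := \sum_i huber U (P x 0 i).

(** With [x'' = x - h rho x], strong monotonicity between [x] and [x''] yields
    the decrease, the Lipschitz bound between [x''] and [x'] the mismatch term,
    and the last term, of second order in the increment, accounts for evaluating
    the saturation at [x'] rather than [x] in [huber_convex]. *)
Lemma huber_potential_step x x' h : 0 < h ->
  huber_potential x' - huber_potential x <=
  h * - (m * dotp (rho x) (rho x)) +
  L * (\sum_i `|rho x 0 i|) * (\sum_j `|x' 0 j - x 0 j + h * rho x 0 j|) +
  N%:R * L ^+ 2 * (\sum_j `|x' 0 j - x 0 j|) ^+ 2.
Proof.
move=> h0; set S := \sum_j `|x' 0 j - x 0 j|.
set S1 := \sum_j `|_ + _|.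
pose x'' := x - h *: rho x.
have S10 : 0 <= S1 by rewrite sumr_ge0.
have step_le i : huber U (P x' 0 i) - huber U (P x 0 i) <=
    `|rho x 0 i| * (L * S1) + rho x 0 i * (P x'' 0 i - P x 0 i) +
    L ^+ 2 * S ^+ 2.
  apply: le_trans (huber_convex U_gt0 _ _) _.
  have := P_lip x' x i; rewrite -/S; have := P_lip x' x'' i.
  have -> : \sum_j `|x' 0 j - x'' 0 j| = S1.
    by apply: eq_bigr => j _; rewrite !mxE; congr `|_|; ring.
  have := saturation_lipschitz U_gt0 (P x' 0 i) (P x 0 i).
  rewrite [rho x 0 i]mxE; move: (saturation U (P x' 0 i)) => r'.
  move: (saturation U (P x 0 i)) => r h1 h2 h3.
  have t1 : (r' - r) * (P x' 0 i - P x 0 i) <= L ^+ 2 * S ^+ 2.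
    rewrite -exprMn expr2; apply: le_trans (ler_norm _) _; rewrite normrM.
    by apply: ler_pM => //; exact: le_trans h3.
  have t2 : r * (P x' 0 i - P x'' 0 i) <= `|r| * (L * S1).
    by apply: le_trans (ler_norm _) _; rewrite normrM ler_wpM2l.
  by move: t1 t2; lra.
rewrite /huber_potential -sumrB.
apply: le_trans (ler_sum _ (fun i _ => step_le i)) _.
rewrite !big_split/= sumr_const card_ord -mulr_natl -mulr_suml.
have xx : x - x'' = h *: rho x by rewrite /x'' opprB addrC subrK.
have := P_mono x x''; rewrite xx.
have -> : dotp (h *: rho x) (h *: rho x) = h ^+ 2 * dotp (rho x) (rho x).
  by rewrite /dotp mulr_sumr; apply: eq_bigr => i _; rewrite !mxE; ring.
have -> : dotp (h *: rho x) (P x - P x'') =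
    - (h * \sum_i rho x 0 i * (P x'' 0 i - P x 0 i)).
  rewrite /dotp mulr_sumr -sumrN.
  by apply: eq_bigr => i _; rewrite !mxE; ring.
set X := \sum_i _ * (P x'' _ _ - _); set Q := dotp _ _ => PX.
have XQ : X <= - (h * (m * Q)) by rewrite -(ler_pM2l h0); nra.
by move: (\sum_i _) => A; lra.
Qed.

Lemma huber_potential_dini (x : R -> 'rV[R]_N) (v : 'rV[R]_N) (t : R) :
  (forall j, is_derive t 1 (fun s => x s 0 j) (v 0 j)) ->
  forall eps : R, 0 < eps -> \forall h \near 0^'+,
    huber_potential (x (t + h)) <= huber_potential (x t) +
      h * (- (m * dotp (rho (x t)) (rho (x t))) +
           L * (\sum_i `|rho (x t) 0 i|) * (\sum_j `|v 0 j + rho (x t) 0 j|) +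
           eps).
Proof.
move=> xD eps eps0; set r := rho (x t).
pose d (h : R) j := h^-1 * (x (t + h) 0 j - x t 0 j).
have dP j : d h j @[h --> 0^'+] --> v 0 j by exact: right_quotient_cvg.
pose q (h : R) := L * (\sum_i `|r 0 i|) * (\sum_j `|d h j + r 0 j|) +
  N%:R * L ^+ 2 * (\sum_j `|d h j|) ^+ 2 * h.
have qP : q h @[h --> 0^'+] -->
    L * (\sum_i `|r 0 i|) * (\sum_j `|v 0 j + r 0 j|).
  have -> : L * (\sum_i `|r 0 i|) * (\sum_j `|v 0 j + r 0 j|) =
      L * (\sum_i `|r 0 i|) * (\sum_j `|v 0 j + r 0 j|) +
      N%:R * L ^+ 2 * (\sum_j `|v 0 j|) ^+ 2 * 0 by rewrite mulr0 addr0.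
  apply: cvgD.
    apply: cvgMl_tmp.
    apply: cvg_sumr => j; apply: cvg_norm.
    by apply: cvgD; [exact: dP|exact: cvg_cst].
  apply: cvgM; last exact: cvg_at_right_filter.
  apply: cvgMl_tmp.
  have dS : \sum_j `|d h j| @[h --> 0^'+] --> \sum_j `|v 0 j|.
    by apply: cvg_sumr => j; apply: cvg_norm; exact: dP.
  by rewrite expr2; apply: (cvgM dS dS).
have : \forall h \near 0^'+,
    q h <= L * (\sum_i `|r 0 i|) * (\sum_j `|v 0 j + r 0 j|) + eps.
  by move/cvgr_le: qP; apply; rewrite ltrDl.
apply: filter_app; near=> h => qh.
have h0 : 0 < h by [].
have := huber_potential_step (x t) (x (t + h)) h0; rewrite -/r.
have E j : x (t + h) 0 j - x t 0 j = h * d h j by rewrite /d mulVKf// gt_eqF.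
have -> : \sum_j `|x (t + h) 0 j - x t 0 j + h * r 0 j| =
    h * \sum_j `|d h j + r 0 j|.
  rewrite mulr_sumr; apply: eq_bigr => j _.
  by rewrite E -mulrDr normrM gtr0_norm.
have -> : \sum_j `|x (t + h) 0 j - x t 0 j| = h * \sum_j `|d h j|.
  by rewrite mulr_sumr; apply: eq_bigr => j _; rewrite E normrM gtr0_norm.
move: qh; rewrite -(ler_pM2l h0) /q.
by move: (\sum_j _) (\sum_j _) (\sum_j _) (\sum_j _) => A B C D; lra.
Unshelve. all: by end_near. Qed.
End Potential.

(** * Coordinates of the state space *)

Lemma is_derive_continuous_linear (R : realType) (V : normedModType R)
    (phi : V -> R) (u : R -> V) (v : V) (t : R) :
  continuous phi ->
  (forall c a b, phi (c *: (a - b)) = c * (phi a - phi b)) ->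
  is_derive t 1 u v -> is_derive t 1 (phi \o u) (phi v).
Proof.
move=> phic phiL [ud uE].
have q0 : h^-1 *: (u (h *: 1 + t) - u t) @[h --> 0^'] --> v by rewrite -uE.
have : phi (h^-1 *: (u (h *: 1 + t) - u t)) @[h --> 0^'] --> phi v.
  exact: (cvg_comp _ _ q0 (phic v)).
under eq_cvg do rewrite phiL.
move=> q; split; first exact: cvgP q.
exact: cvg_lim q.
Qed.

Section StateCoordinates.
Variables (R : realType) (N : nat).
Local Notation V := ('rV[R]_N * 'M[R]_N)%type.

Lemma action_continuous j : continuous (fun s : V => s.1 0 j).
Proof.
move=> s; apply: (@continuous_comp _ _ _ fst (fun x : 'rV[R]_N => x 0 j)).
  exact: cvg_fst.
exact: coord_continuous.
Qed.

Lemma estimate_continuous i j : continuous (fun s : V => s.2 i j).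
Proof.
move=> s; apply: (@continuous_comp _ _ _ snd (fun y : 'M[R]_N => y i j)).
  exact: cvg_snd.
exact: coord_continuous.
Qed.

Lemma is_derive_action (u : R -> V) (v : V) (t : R) j :
  is_derive t 1 u v -> is_derive t 1 (fun s => (u s).1 0 j) (v.1 0 j).
Proof.
apply: (is_derive_continuous_linear (phi := fun s : V => s.1 0 j)).
  exact: action_continuous.
by move=> c a b; rewrite !mxE.
Qed.

Lemma is_derive_estimate (u : R -> V) (v : V) (t : R) i j :
  is_derive t 1 u v -> is_derive t 1 (fun s => (u s).2 i j) (v.2 i j).
Proof.
apply: (is_derive_continuous_linear (phi := fun s : V => s.2 i j)).
  exact: estimate_continuous.
by move=> c a b; rewrite !mxE.
Qed.

Lemma is_derive_state (u : R -> V) (v : V) (t : R) :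
  (forall j, is_derive t 1 (fun s => (u s).1 0 j) (v.1 0 j)) ->
  (forall i j, is_derive t 1 (fun s => (u s).2 i j) (v.2 i j)) ->
  is_derive t 1 u v.
Proof.
move=> u1 u2.
have mx m n (w : R -> 'M[R]_(m, n)) (dw : 'M[R]_(m, n)) :
    (forall i j, is_derive t 1 (fun s => w s i j) (dw i j)) ->
    h^-1 *: (w (h *: 1 + t) - w t) @[h --> 0^'] --> dw.
  move=> wD; have wd : derivable w t 1.
    by apply/derivable_mxP => i j; have [] := wD i j.
  have -> : dw = 'D_1 w t.
    rewrite derive_mx//; apply/matrixP => i j; rewrite mxE.
    by have [_ ->] := wD i j.
  exact: wd.
have q : h^-1 *: (u (h *: 1 + t) - u t) @[h --> 0^'] --> v.
  have q1 := @mx _ _ (fun s => (u s).1) v.1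
    (fun i => ltac:(rewrite ord1; exact: u1)).
  have q2 := @mx _ _ (fun s => (u s).2) v.2 u2.
  have := cvg_pair q1 q2.
  by case: (v) q1 q2 => v1 v2 _ _; apply.
split; first exact: cvgP q.
exact: cvg_lim q.
Qed.

Lemma entry_le_norm m n (M : 'M[R]_(m, n)) i j : `|M i j| <= `|M|.
Proof.
by rewrite [leRHS]/Num.Def.normr/= mx_normrE; exact: (le_bigmax _ _ (i, j)).
Qed.

Lemma mx_norm_lt m n (M : 'M[R]_(m, n)) (c : R) : 0 < c ->
  (forall i j, `|M i j| < c) -> `|M| < c.
Proof.
move=> c0 Mc; rewrite [ltLHS]/Num.Def.normr/= mx_normrE.
by apply/bigmax_ltP; split=> // -[i j] _; exact: Mc.
Qed.

Lemma state_norm_lt (s : V) (c : R) : 0 < c ->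
  (forall j, `|s.1 0 j| < c) -> (forall i j, `|s.2 i j| < c) -> `|s| < c.
Proof.
move=> c0 s1 s2; rewrite prod_normE gt_max; apply/andP; split.
  by apply: mx_norm_lt => // i j; rewrite ord1.
exact: mx_norm_lt.
Qed.

Lemma action_le_norm (s : V) j : `|s.1 0 j| <= `|s|.
Proof. by rewrite prod_normE le_max entry_le_norm. Qed.

Lemma estimate_le_norm (s : V) i j : `|s.2 i j| <= `|s|.
Proof. by rewrite prod_normE le_max entry_le_norm orbT. Qed.

End StateCoordinates.

(** * The energy of the seeking dynamics and its decrease *)

(** Here [A] and [B] stand for [|r|^2] and [|e|^2], [S1] and [S2] for the
    corresponding sums of absolute values.  Young's inequality absorbs the cross
    terms [S1 * S2] into half of [m * A] and a multiple of [B], which a large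
    gain [th] dominates. *)
Lemma coupling_bound (R : realFieldType) (m L b n lam th A B S1 S2 : R) :
  0 < m -> 0 <= L -> 0 <= b -> 0 < n ->
  ((L ^+ 2 + b) ^+ 2 * n / (2 * m) + b * L) * n ^+ 2 + m / 2 <= th * lam ->
  0 <= B -> S1 ^+ 2 <= n * A -> S2 ^+ 2 <= n ^+ 2 * B ->
  - (m * A) + L * S1 * (L * S2) - th * lam * B + b * S2 * (S1 + L * S2) <=
  - (m / 2 * (A + B)).
Proof.
move=> m0 L0 b0 n0; set g := L ^+ 2 + b.
set c := g ^+ 2 * n / (2 * m) => hth B0 hA hB.
have young : g * S1 * S2 <= m / (2 * n) * S1 ^+ 2 + c * S2 ^+ 2.
  rewrite -subr_ge0 (_ : _ - _ = (m * S1 - g * n * S2) ^+ 2 / (2 * m * n)).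
    by rewrite divr_ge0 ?sqr_ge0// !mulr_ge0// ltW.
  by rewrite /c; field; rewrite !gt_eqF.
have h1 : m / (2 * n) * S1 ^+ 2 <= m / 2 * A.
  have -> : m / 2 * A = m / (2 * n) * (n * A) by field; rewrite gt_eqF.
  by rewrite ler_wpM2l// divr_ge0 ?mulr_ge0// ltW.
have [n0' m0'] := (ltW n0, ltW m0).
have c0 : 0 <= c by rewrite /c divr_ge0// mulr_ge0 ?sqr_ge0//.
have h2 : (c + b * L) * S2 ^+ 2 <= (c + b * L) * (n ^+ 2 * B).
  by rewrite ler_wpM2l// addr_ge0// mulr_ge0.
have h3 := ler_wpM2r B0 hth.
move: young h1 h2 h3; rewrite /g; move: (c) (m / (2 * n)) => c' k.
by move=> *; lra.
Qed.

Section Seeking.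
Variables (R : realType) (N : nat) (f : 'I_N -> 'rV[R]_N -> R) (e : rel 'I_N).
Variables (U m L : R) (tb : 'I_N -> 'I_N -> R).
Hypothesis N_ge2 : (2 <= N)%N.
Hypothesis e_sym : symmetric e.
Hypothesis e_connected : connected_graph e.
Hypothesis U_gt0 : 0 < U.
Hypothesis m_gt0 : 0 < m.
Hypothesis L_ge0 : 0 <= L.
Hypothesis tb_gt0 : forall i j, 0 < tb i j.
Let P := pseudo_gradient f.
Hypothesis P_mono : forall x z,
  m * dotp (x - z) (x - z) <= dotp (x - z) (P x - P z).
Hypothesis P_lip : forall x z i,
  `|P x 0 i - P z 0 i| <= L * \sum_j `|x 0 j - z 0 j|.

Local Notation V := ('rV[R]_N * 'M[R]_N)%type.
Let a := adjacency R e.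
Let rho := saturated_field P U.
Let F (th : R) : V -> V := seeking_dynamics f a U (fun i j => th * tb i j).

Definition estimation_error (s : V) (i j : 'I_N) : R := s.2 i j - s.1 0 j.
Let err := estimation_error.

(** Dividing by [tb i j] cancels the individual gains of the estimates, so that
    the derivative of the second sum features the symmetric forms
    [consensus_form]. *)
Definition energy (s : V) : R :=
  huber_potential P U s.1 + \sum_i \sum_j err s i j ^+ 2 / (2 * tb i j).

Definition dissipation (s : V) : R :=
  dotp (rho s.1) (rho s.1) + \sum_i \sum_j err s i j ^+ 2.

(** The first two terms come from [huber_potential_dini]; the last one is the
    derivative of the error part of [energy] along the flow. *)
Definition energy_rate (th : R) (s : V) : R :=
  - (m * dotp (rho s.1) (rho s.1)) +
  L * (\sum_i `|rho s.1 0 i|) * (\sum_j `|(F th s).1 0 j + rho s.1 0 j|) +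
  \sum_i \sum_j err s i j * ((F th s).2 i j - (F th s).1 0 j) / tb i j.

Lemma action_velocityE th s j :
  (F th s).1 0 j = - saturation U (P (row j s.2) 0 j).
Proof. by case: s => x y; rewrite /F /seeking_dynamics /P !mxE. Qed.

Lemma estimate_velocityE th s i j :
  (F th s).2 i j = - (th * tb i j) *
    (\sum_k a i k * (err s i j - err s k j) + a i j * err s i j).
Proof.
case: s => x y; rewrite /F /seeking_dynamics mxE /err /estimation_error/=.
congr (_ * (_ + _)); apply: eq_bigr => k _; congr (_ * _).
by rewrite opprB addrA subrK.
Qed.

Lemma velocity_mismatch_le th s :
  \sum_j `|(F th s).1 0 j + rho s.1 0 j| <= L * \sum_i \sum_j `|err s i j|.
Proof.
rewrite mulr_sumr; apply: ler_sum => j _.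
rewrite action_velocityE [rho _ _ _]mxE addrC.
apply: le_trans (saturation_lipschitz U_gt0 _ _) _.
apply: le_trans (P_lip _ _ _) _.
rewrite ler_wpM2l//; apply: ler_sum => k _.
by rewrite mxE distrC.
Qed.

Lemma energy_rate_le : exists th_star : R, 0 < th_star /\
  forall (th : R) s, th_star < th ->
    energy_rate th s <= - (m / 2 * dissipation s).
Proof.
have [lam lam0 lamP] := consensus_form_pos_def R e_sym N_ge2 e_connected.
pose b := \sum_i \sum_j (tb i j)^-1.
have bP i j : (tb i j)^-1 <= b.
  rewrite /b (bigD1 i)//= (bigD1 j)//= -addrA lerDl addr_ge0//.
    by rewrite sumr_ge0// => ? _; rewrite invr_ge0 ltW.
  by rewrite sumr_ge0// => ? _; rewrite sumr_ge0// => ? _; rewrite invr_ge0 ltW.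
have b0 : 0 <= b.
  by rewrite sumr_ge0// => ? _; rewrite sumr_ge0// => ? _; rewrite invr_ge0 ltW.
pose n : R := N%:R.
have n0 : 0 < n by rewrite ltr0n (leq_trans _ N_ge2).
pose num := ((L ^+ 2 + b) ^+ 2 * n / (2 * m) + b * L) * n ^+ 2 + m / 2.
have num0 : 0 < num.
  have [n0' m0'] := (ltW n0, ltW m_gt0).
  rewrite ltr_wpDl ?divr_gt0// mulr_ge0 ?sqr_ge0//.
  rewrite addr_ge0//; last exact: mulr_ge0.
  by rewrite divr_ge0// mulr_ge0// sqr_ge0.
exists (num / lam); split; first by rewrite divr_gt0.
move=> th s; rewrite ltr_pdivrMr// => hth.
have th0 : 0 <= th by rewrite -(pmulr_lge0 _ lam0) ltW// (lt_trans num0).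
set A := dotp (rho s.1) (rho s.1).
pose B := \sum_i \sum_j err s i j ^+ 2.
pose S1 := \sum_i `|rho s.1 0 i|.
pose S2 := \sum_i \sum_j `|err s i j|.
have S10 : 0 <= S1 by rewrite sumr_ge0.
have S20 : 0 <= S2 by rewrite sumr_ge0// => ? _; rewrite sumr_ge0.
have B0 : 0 <= B.
  by rewrite sumr_ge0// => ? _; rewrite sumr_ge0// => ? _; rewrite sqr_ge0.
have S1A : S1 ^+ 2 <= n * A by exact: sum_norm_sqr_le.
have S2B : S2 ^+ 2 <= n ^+ 2 * B.
  apply: le_trans (sqr_sum_le _) _.
  rewrite card_ord expr2 -mulrA ler_wpM2l ?ler0n//.
  rewrite /B mulr_sumr; apply: ler_sum => i _.
  apply: le_trans (sqr_sum_le _) _; rewrite card_ord ler_wpM2l ?ler0n//.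
  by apply: ler_sum => j _; rewrite real_normK ?num_real.
have mis := velocity_mismatch_le th s; rewrite -/S2 in mis.
have vel : \sum_j `|(F th s).1 0 j| <= S1 + L * S2.
  apply: (@le_trans _ _
    (\sum_j (`|rho s.1 0 j| + `|(F th s).1 0 j + rho s.1 0 j|))).
    apply: ler_sum => j _.
    rewrite -[in leLHS](addrK (rho s.1 0 j) ((F th s).1 0 j)).
    by rewrite addrC; apply: le_trans (ler_normD _ _) _; rewrite normrN.
  by rewrite big_split/= lerD2l.
have cross : - (\sum_i \sum_j err s i j * (F th s).1 0 j / tb i j) <=
    b * S2 * (S1 + L * S2).
  apply: (@le_trans _ _
    (\sum_i \sum_j b * `|err s i j| * (S1 + L * S2))); last first.
    move: (S1 + L * S2) => K; rewrite /S2 mulr_sumr mulr_suml.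
    by apply: ler_sum => i _; rewrite mulr_sumr mulr_suml.
  rewrite -sumrN; apply: ler_sum => i _; rewrite -sumrN; apply: ler_sum => j _.
  apply: le_trans (ler_norm _) _.
  rewrite normrN !normrM normfV (gtr0_norm (tb_gt0 i j)).
  rewrite mulrC mulrA; apply: ler_pM => //.
  - by rewrite mulr_ge0// invr_ge0 ltW.
  - by rewrite ler_wpM2r.
  - by apply: le_trans vel; rewrite (bigD1 j)//= lerDl sumr_ge0.
have track : \sum_i \sum_j err s i j * (F th s).2 i j / tb i j <=
    - (th * lam * B).
  have -> : \sum_i \sum_j err s i j * (F th s).2 i j / tb i j =
      - (th * \sum_j consensus_form e j (fun i => err s i j)).
    rewrite exchange_big/= mulr_sumr -sumrN; apply: eq_bigr => j _.
    rewrite /consensus_form mulr_sumr -sumrN; apply: eq_bigr => i _.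
    by rewrite estimate_velocityE; field; rewrite gt_eqF.
  rewrite lerN2 -mulrA ler_wpM2l// /B exchange_big/= mulr_sumr.
  by apply: ler_sum => j _; exact: lamP.
have W : \sum_i \sum_j err s i j * ((F th s).2 i j - (F th s).1 0 j) / tb i j <=
    - (th * lam * B) + b * S2 * (S1 + L * S2).
  apply: le_trans (lerD track cross).
  rewrite -sumrB; apply: ler_sum => i _; rewrite -sumrB; apply: ler_sum => j _.
  by rewrite mulrBr mulrBl.
rewrite /energy_rate /dissipation -/A -/B -/S1.
have := coupling_bound m_gt0 L_ge0 b0 n0 (ltW hth) B0 S1A S2B.
apply: le_trans; rewrite -addrA [X in _ <= X]addrAC -!addrA lerD2l.
have : L * S1 * (\sum_j `|(F th s).1 0 j + rho s.1 0 j|) <= L * S1 * (L * S2).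
  by rewrite ler_wpM2l// mulr_ge0.
by move: W; lra.
Qed.

Lemma energy_dini th (u : R -> V) (t : R) : is_derive t 1 u (F th (u t)) ->
  forall eps : R, 0 < eps -> \forall h \near 0^'+,
    energy (u (t + h)) <= energy (u t) + h * (energy_rate th (u t) + eps).
Proof.
move=> uD eps eps0; set v := F th (u t).
have e2 : 0 < eps / 2 by rewrite divr_gt0.
have potD := huber_potential_dini U_gt0 P_mono P_lip
  (fun j => is_derive_action j uD) e2.
pose w s i j := err (u s) i j ^+ 2 / (2 * tb i j).
pose dw i j := err (u t) i j * (v.2 i j - v.1 0 j) / tb i j.
have wD i j : is_derive t 1 (fun s => w s i j) (dw i j).
  pose g s := err (u s) i j.
  have gD : is_derive t 1 g (v.2 i j - v.1 0 j).
    by apply: is_deriveB; [exact: is_derive_estimate|exact: is_derive_action].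
  have -> : (fun s => w s i j) = (2 * tb i j)^-1 *: (g * g).
    by apply/funext => s; rewrite /w /= mulrC expr2.
  have -> : dw i j = (2 * tb i j)^-1 *:
      (g t *: (v.2 i j - v.1 0 j) + g t *: (v.2 i j - v.1 0 j)).
    by rewrite /dw /g/= /GRing.scale/=; field; rewrite gt_eqF.
  exact: is_deriveZ.
have qP : \sum_i \sum_j h^-1 * (w (t + h) i j - w t i j) @[h --> 0^'+] -->
    \sum_i \sum_j dw i j.
  by do 2!apply: cvg_sumr => ?; exact: right_quotient_cvg.
have qD : \forall h \near 0^'+,
    \sum_i \sum_j h^-1 * (w (t + h) i j - w t i j) <=
    \sum_i \sum_j dw i j + eps / 2.
  by move/cvgr_le: qP; apply; rewrite ltrDl.
near=> h.
have h0 : 0 < h by [].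
have h1 : huber_potential P U (u (t + h)).1 <= huber_potential P U (u t).1 +
      h * (- (m * dotp (rho (u t).1) (rho (u t).1)) +
           L * (\sum_i `|rho (u t).1 0 i|) *
             (\sum_j `|v.1 0 j + rho (u t).1 0 j|) +
           eps / 2) by near: h.
have : \sum_i \sum_j h^-1 * (w (t + h) i j - w t i j) <=
    \sum_i \sum_j dw i j + eps / 2 by near: h.
rewrite -(ler_pM2l h0).
have -> : h * (\sum_i \sum_j h^-1 * (w (t + h) i j - w t i j)) =
    \sum_i \sum_j w (t + h) i j - \sum_i \sum_j w t i j.
  rewrite mulr_sumr -sumrB; apply: eq_bigr => i _.
  rewrite mulr_sumr -sumrB; apply: eq_bigr => j _.
  by rewrite mulVKf// gt_eqF.
move: h1; rewrite /energy /energy_rate -/v -/(w _ _ _) -/(dw _ _).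
by move=> h1 h2; lra.
Unshelve. all: by end_near. Qed.

Lemma dissipation_ge0 s : 0 <= dissipation s.
Proof.
by rewrite addr_ge0 ?dotp_ge0// !sumr_ge0// => i _; rewrite sumr_ge0// => j _;
  rewrite sqr_ge0.
Qed.

Lemma energy_ge0 s : 0 <= energy s.
Proof.
rewrite addr_ge0//; first by rewrite sumr_ge0// => i _; exact: huber_ge0.
rewrite sumr_ge0// => i _; rewrite sumr_ge0// => j _.
by rewrite divr_ge0 ?sqr_ge0// mulr_ge0// ltW.
Qed.

Lemma energy_continuous : continuous energy.
Proof.
have P_cont i : continuous (fun s : V => P s.1 0 i).
  move=> s.
  pose d (s' : V) := L * \sum_j `|s.1 0 j - s'.1 0 j|.
  have d0 : d s' @[s' --> s] --> (0 : R).
    have -> : (0 : R) = L * \sum_j `|s.1 0 j - s.1 0 j|.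
      by rewrite big1 ?mulr0// => j _; rewrite subrr normr0.
    apply: cvgMl_tmp; apply: cvg_sumr => j; apply: cvg_norm.
    by apply: cvgB; [exact: cvg_cst|exact: action_continuous].
  apply/cvgrPdist_le => /= eps eps0; near=> s'.
  apply: le_trans (P_lip _ _ _) _; near: s'.
  by move/cvgr_le: d0; apply.
have sat_cont : continuous (saturation U).
  move=> p; apply/cvgrPdist_le => /= eps eps0; near=> q.
  apply: le_trans (saturation_lipschitz U_gt0 _ _) _; near: q.
  by have /cvgrPdist_le/(_ _ eps0) := @cvg_id _ (nbhs p).
move=> s; apply: cvgD; last first.
  apply: cvg_sumr => i; apply: cvg_sumr => j.
  apply: cvgMr_tmp; rewrite expr2.
  have errc : (err^~ i)^~ j @ s --> err s i j.
    by apply: cvgB; [exact: estimate_continuous|exact: action_continuous].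
  by under eq_cvg do rewrite expr2; apply: cvgM.
apply: cvg_sumr => i.
have satc : (fun s' : V => saturation U (P s'.1 0 i)) @ s -->
    saturation U (P s.1 0 i).
  exact: (@continuous_comp _ _ _ (fun s : V => P s.1 0 i) (saturation U) s
    (P_cont i s) (sat_cont _)).
apply: cvgB; first by apply: cvgM => //; exact: P_cont.
by apply: cvgMr_tmp; under eq_cvg do rewrite expr2; rewrite expr2; apply: cvgM.
Unshelve. all: by end_near. Qed.

Lemma energy_descent th u c s t : ode_solution (F th) u -> 0 <= s <= t ->
  (forall r, s < r < t -> energy_rate th (u r) <= - c) ->
  energy (u t) <= energy (u s) - c * (t - s).
Proof.
move=> [uc uD] /andP[s0 st] rate_le.
pose phi r := energy (u r) + c * r.
suff : phi t <= phi s by rewrite /phi; lra.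
apply: dini_nonincreasing => //.
  have sub : `[s, t]%classic `<=` `[0, +oo[%classic.
    by move=> r /=; rewrite !in_itv/= andbT => /andP[sr _]; exact: le_trans sr.
  have eu : {within `[s, t], continuous (fun r => energy (u r))}.
    apply: continuous_subspaceW sub _ => r.
    exact: (cvg_comp _ _ (uc r) (@energy_continuous (u r))).
  have cc : {within `[s, t], continuous (fun r => c * r)}.
    by apply: continuous_subspaceT => r; apply: cvgMl_tmp; exact: cvg_id.
  exact: (within_continuousD eu cc).
move=> r rst eps eps0.
have r0 : 0 < r by case/andP: rst => sr _; exact: le_lt_trans sr.
have := energy_dini (uD r r0) eps0; apply: filter_app; near=> h => uh.
have h0 : 0 < h by [].
have := rate_le r rst; rewrite -(ler_pM2l h0) /phi.
by move: uh; lra.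
Unshelve. all: by end_near. Qed.

(** The restriction to a sublevel set comes from [huber_le_saturation]. *)
Lemma energy_le_dissipation c : 0 <= c -> exists2 K, 0 < K &
  forall s, energy s <= c -> energy s <= K * dissipation s.
Proof.
move=> c0; pose b := \sum_i \sum_j (2 * tb i j)^-1.
have t20 i j : 0 <= (2 * tb i j)^-1 by rewrite invr_ge0 mulr_ge0// ltW.
have bP i j : (2 * tb i j)^-1 <= b.
  rewrite /b (bigD1 i)//= (bigD1 j)//= -addrA lerDl addr_ge0//.
    by rewrite sumr_ge0.
  by rewrite sumr_ge0// => ? _; rewrite sumr_ge0.
have b0 : 0 <= b by rewrite sumr_ge0// => ? _; rewrite sumr_ge0.
pose k := 1 / 2 + c / U ^+ 2.
have k0 : 0 < k by rewrite ltr_wpDr// divr_ge0// sqr_ge0.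
exists (k + b) => [|s sc]; first by rewrite ltr_wpDr.
have V_le i : huber U (P s.1 0 i) <= energy s.
  rewrite /energy /huber_potential (bigD1 i)//= -addrA lerDl addr_ge0//.
    by rewrite sumr_ge0// => ? _; exact: huber_ge0.
  rewrite sumr_ge0// => ? _; rewrite sumr_ge0// => ? _.
  by rewrite mulr_ge0 ?sqr_ge0.
have h1 : huber_potential P U s.1 <= k * dotp (rho s.1) (rho s.1).
  rewrite /huber_potential /dotp mulr_sumr; apply: ler_sum => i _.
  rewrite [rho _ _ _]mxE -expr2; apply: huber_le_saturation => //.
  exact: le_trans (V_le i) sc.
have h2 : \sum_i \sum_j err s i j ^+ 2 / (2 * tb i j) <=
    b * \sum_i \sum_j err s i j ^+ 2.
  rewrite mulr_sumr; apply: ler_sum => i _; rewrite mulr_sumr.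
  by apply: ler_sum => j _; rewrite mulrC ler_wpM2r ?sqr_ge0.
rewrite /energy /dissipation; have := dotp_ge0 (rho s.1).
have : 0 <= \sum_i \sum_j err s i j ^+ 2.
  by rewrite sumr_ge0// => ? _; rewrite sumr_ge0// => ? _; rewrite sqr_ge0.
by move: h1 h2; nra.
Qed.

(** * Global asymptotic stability of the equilibrium *)

Section Equilibrium.
Variable xs : 'rV[R]_N.
Hypothesis xs0 : P xs = 0.
Let p := consensus_state xs.

Lemma seeking_equilibrium th : F th p = 0.
Proof.
have pE i j : err p i j = 0 by rewrite /err /estimation_error /p/= mxE subrr.
suff [h1 h2] : (F th p).1 = 0 /\ (F th p).2 = 0.
  by move: h1 h2; case: (F th p) => /= ? ? -> ->.
split.
  apply/rowP => j; rewrite action_velocityE [RHS]mxE (_ : row j p.2 = xs).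
    by rewrite xs0 mxE saturation0 oppr0.
  by apply/rowP => k; rewrite !mxE.
apply/matrixP => i j; rewrite estimate_velocityE [RHS]mxE.
rewrite big1 ?pE ?mulr0 ?addr0 ?mulr0//.
by move=> k _; rewrite !pE subrr mulr0.
Qed.

Lemma energy_le_norm :
  exists2 K, 0 < K & forall s, energy s <= K * `|s - p| ^+ 2.
Proof.
pose b := \sum_i \sum_j (2 * tb i j)^-1.
have t20 i j : 0 <= (2 * tb i j)^-1 by rewrite invr_ge0 mulr_ge0// ltW.
have b0 : 0 <= b by rewrite sumr_ge0// => ? _; rewrite sumr_ge0.
pose k := N%:R * ((L * N%:R) ^+ 2 / 2) + b * 4 + 1.
have k0 : 0 <= N%:R * ((L * N%:R) ^+ 2 / 2) :> R.
  by rewrite mulr_ge0 ?divr_ge0 ?sqr_ge0.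
exists k => [|s]; first by rewrite /k; lra.
set d := `|s - p|.
have dx j : `|s.1 0 j - xs 0 j| <= d.
  by have := action_le_norm (s - p) j; rewrite !mxE.
have dy i j : `|s.2 i j - xs 0 j| <= d.
  by have := estimate_le_norm (s - p) i j; rewrite !mxE.
have d0 : 0 <= d by exact: normr_ge0.
have h1 : huber_potential P U s.1 <= N%:R * ((L * N%:R) ^+ 2 / 2) * d ^+ 2.
  apply: (@le_trans _ _ (\sum_(i < N) (L * N%:R) ^+ 2 / 2 * d ^+ 2)).
    apply: ler_sum => i _; apply: le_trans (huber_le_sqr U_gt0 _) _.
    rewrite [leRHS]mulrAC ler_wpM2r// -exprMn.
    rewrite -(real_normK (num_real (P _ _ _))).
    rewrite ler_sqr ?nnegrE// ?mulr_ge0//.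
    have := P_lip s.1 xs i; rewrite xs0 [X in _ - X]mxE subr0.
    move=> /le_trans; apply; rewrite -mulrA ler_wpM2l//.
    rewrite -[N in N%:R]card_ord -sum1_card natr_sum mulr_suml.
    by apply: ler_sum => j _; rewrite mul1r.
  by rewrite sumr_const card_ord -[leLHS]mulr_natl [leLHS]mulrA.
have h2 : \sum_i \sum_j err s i j ^+ 2 / (2 * tb i j) <= b * 4 * d ^+ 2.
  rewrite /b -mulrA mulr_suml; apply: ler_sum => i _; rewrite mulr_suml.
  apply: ler_sum => j _; rewrite mulrC ler_wpM2l//.
  have -> : err s i j = (s.2 i j - xs 0 j) - (s.1 0 j - xs 0 j).
    by rewrite /err /estimation_error; ring.
  have := dx j; have := dy i j; rewrite !ler_norml => /andP[? ?] /andP[? ?].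
  by nra.
have := sqr_ge0 d; rewrite /energy /k.
by move: h1 h2; lra.
Qed.

(** Below the level [U^2 / 2] no component of [P x] is saturated, so the
    potential is [|P x|^2 / 2], and [m |x - xs| <= |P x|] by strong
    monotonicity. *)
Lemma energy_lt_norm_lt : exists2 K, 0 < K & forall s eps, 0 < eps ->
  energy s < U ^+ 2 / 2 -> K * energy s < eps ^+ 2 -> `|s - p| < eps.
Proof.
pose T := \sum_i \sum_j tb i j.
have TP i j : tb i j <= T.
  rewrite /T (bigD1 i)//= (bigD1 j)//= -addrA lerDl addr_ge0//.
    by rewrite sumr_ge0// => ? _; rewrite ltW.
  by rewrite sumr_ge0// => ? _; rewrite sumr_ge0// => ? _; rewrite ltW.
have T0 : 0 <= T.
  by rewrite sumr_ge0// => ? _; rewrite sumr_ge0// => ? _; rewrite ltW.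
have m2 : 0 < (m ^+ 2)^-1 by rewrite invr_gt0 exprn_gt0.
exists (4 * T + 4 / m ^+ 2) => [|s eps eps0 sU seps].
  by rewrite ltr_wpDl ?mulr_ge0// mulr_gt0.
set E := energy s in sU seps.
have E0 : 0 <= E by exact: energy_ge0.
have V_le i : huber U (P s.1 0 i) <= huber_potential P U s.1.
  rewrite /huber_potential (bigD1 i)//= lerDl.
  by rewrite sumr_ge0// => ? _; exact: huber_ge0.
have W0 i j : 0 <= err s i j ^+ 2 / (2 * tb i j).
  by rewrite divr_ge0 ?sqr_ge0// mulr_ge0// ltW.
have VE : huber_potential P U s.1 <= E.
  by rewrite lerDl sumr_ge0// => ? _; rewrite sumr_ge0.
have Q : dotp (P s.1) (P s.1) <= 2 * E.
  apply: le_trans (ler_wpM2l _ VE) => //.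
  rewrite /dotp /huber_potential mulr_sumr; apply: ler_sum => i _.
  rewrite -expr2 (@huber_small _ U)//.
  by apply: le_lt_trans sU; exact: le_trans (V_le i) VE.
have hx j : (s.1 0 j - xs 0 j) ^+ 2 <= 2 / m ^+ 2 * E.
  have := sqr_le_dotp (s.1 - xs) j; rewrite !mxE => /le_trans; apply.
  have := P_mono s.1 xs; rewrite xs0 subr0.
  have := dotp_ge0 (m *: (s.1 - xs) - 1 *: P s.1); rewrite dotp_subZ.
  have -> : dotp (m *: (s.1 - xs)) (m *: (s.1 - xs)) =
      m ^+ 2 * dotp (s.1 - xs) (s.1 - xs).
    by rewrite /dotp mulr_sumr; apply: eq_bigr => i _; rewrite !mxE; ring.
  have -> : dotp (m *: (s.1 - xs)) (P s.1) = m * dotp (s.1 - xs) (P s.1).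
    by rewrite /dotp mulr_sumr; apply: eq_bigr => i _; rewrite !mxE; ring.
  set D := dotp (s.1 - xs) (s.1 - xs); set G := dotp (s.1 - xs) _ => h1 h2.
  rewrite mulrAC ler_pdivlMr ?exprn_gt0//.
  by have := ler_wpM2l (ltW m_gt0) h2; move: h1 Q; lra.
have hy i j : err s i j ^+ 2 <= 2 * T * E.
  have tb2 : 0 < 2 * tb i j by rewrite mulr_gt0.
  have : err s i j ^+ 2 / (2 * tb i j) <= E.
    apply: (@le_trans _ _ (\sum_i \sum_j err s i j ^+ 2 / (2 * tb i j))).
      rewrite (bigD1 i)//= (bigD1 j)//= -addrA lerDl addr_ge0//.
        by rewrite sumr_ge0.
      by rewrite sumr_ge0// => ? _; rewrite sumr_ge0.
    by rewrite lerDr sumr_ge0// => ? _; exact: huber_ge0.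
  rewrite ler_pdivrMr// => /le_trans; apply; rewrite mulrC ler_wpM2r//.
  by rewrite ler_wpM2l.
have small z : z ^+ 2 < eps ^+ 2 -> `|z| < eps.
  by rewrite -(real_normK (num_real z)) ltr_pXn2r ?nnegrE// ltW.
have T2E : 0 <= T * E by exact: mulr_ge0.
have M2E : 0 <= E / m ^+ 2 by rewrite mulr_ge0// ltW.
apply: state_norm_lt => // [j|i j].
  apply: small; rewrite !mxE; have := hx j; move: seps.
  have -> : (4 * T + 4 / m ^+ 2) * E = 4 * (T * E) + 4 * (E / m ^+ 2) by ring.
  by rewrite mulrAC -mulrA; lra.
apply: small; rewrite !mxE.
have -> : s.2 i j - xs 0 j = err s i j + (s.1 0 j - xs 0 j).
  by rewrite /err /estimation_error; ring.
have := hx j; have := hy i j; move: seps.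
have -> : (4 * T + 4 / m ^+ 2) * E = 4 * (T * E) + 4 * (E / m ^+ 2) by ring.
have -> : 2 / m ^+ 2 * E = 2 * (E / m ^+ 2) by ring.
move: (err s i j) (_ - _) => A B; have := sqr_ge0 (A - B).
by move: (E / _) => Z; nra.
Qed.

Lemma seeking_stable th :
  (forall s, energy_rate th s <= - (m / 2 * dissipation s)) ->
  lyapunov_stable (F th) p.
Proof.
move=> rate_le eps eps0.
have [K1 K10 leK1] := energy_le_norm; have [K2 K20 leK2] := energy_lt_norm_lt.
pose c := Num.min (U ^+ 2 / 2) (eps ^+ 2 / K2).
have c0 : 0 < c by rewrite lt_min !divr_gt0 ?exprn_gt0.
exists (Num.sqrt (c / K1)); split; first by rewrite sqrtr_gt0 divr_gt0.
move=> u uS u0 t t0.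
have E0 : energy (u 0) < c.
  apply: le_lt_trans (leK1 _) _; rewrite mulrC -ltr_pdivlMr//.
  rewrite -[ltRHS]sqr_sqrtr ?divr_ge0 ?ltW//.
  by rewrite ltr_pXn2r ?nnegrE// ?sqrtr_ge0.
have Et : energy (u t) < c.
  apply: le_lt_trans E0.
  have := @energy_descent th u 0 0 t uS; rewrite lexx mul0r subr0; apply=> //.
  move=> r _; rewrite oppr0; apply: le_trans (rate_le _) _.
  by rewrite oppr_le0 mulr_ge0 ?dissipation_ge0// ltW// divr_gt0.
move: Et; rewrite lt_min => /andP[h1 h2]; apply: leK2 => //.
by rewrite mulrC -ltr_pdivlMr.
Qed.

(** As long as the energy stays above a level [c], it decreases at least at the
    constant rate [k]; being nonnegative, it falls below [c] by the time
    [energy (u 0) / k]. *)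
Lemma seeking_attractive th :
  (forall s, energy_rate th s <= - (m / 2 * dissipation s)) ->
  forall u, ode_solution (F th) u -> u t @[t --> +oo] --> p.
Proof.
move=> rate_le u uS.
have mono (s t : R) : 0 <= s <= t -> energy (u t) <= energy (u s).
  move=> st; have := @energy_descent th u 0 s t uS st.
  rewrite mul0r subr0; apply.
  move=> r _; rewrite oppr0; apply: le_trans (rate_le _) _.
  by rewrite oppr_le0 mulr_ge0 ?dissipation_ge0// ltW// divr_gt0.
have [K K0 leK] := energy_le_dissipation (energy_ge0 (u 0)).
have [K2 K20 leK2] := energy_lt_norm_lt.
apply/cvgrPdist_lt => eps eps0.
pose c := Num.min (U ^+ 2 / 2) (eps ^+ 2 / K2).
have c0 : 0 < c by rewrite lt_min !divr_gt0 ?exprn_gt0.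
pose k := m / 2 * (c / K).
have k0 : 0 < k by rewrite mulr_gt0 ?divr_gt0.
near=> t.
have t0 : 0 <= t by near: t; exact: nbhs_pinfty_ge.
have tk : energy (u 0) / k < t.
  by near: t; apply: nbhs_pinfty_gt; rewrite num_real.
have Et : energy (u t) < c.
  rewrite ltNge; apply/negP => cE.
  have rate r : 0 < r < t -> energy_rate th (u r) <= - k.
    move=> /andP[r0 rt]; apply: le_trans (rate_le _) _.
    rewrite lerN2; apply: ler_wpM2l; first by rewrite divr_ge0// ltW.
    rewrite ler_pdivrMr// mulrC.
    apply: le_trans (leK _ _); last by apply: mono; rewrite lexx ltW.
    by apply: le_trans cE (mono _ _ _); rewrite !ltW.
  have := energy_descent uS (s := 0) (t := t) _ rate.
  rewrite lexx t0 => /(_ isT).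
  have := energy_ge0 (u t); move: tk; rewrite ltr_pdivrMr// subr0 mulrC.
  by lra.
rewrite distrC; move: Et; rewrite lt_min => /andP[h1 h2]; apply: leK2 => //.
by rewrite mulrC -ltr_pdivlMr.
Unshelve. all: by end_near. Qed.

End Equilibrium.

(** In the supremum norm of the coordinates, an error [e_ij] is 2-Lipschitz and
    a difference of two errors 4-Lipschitz, whence the constant [4 N + 2] for
    the velocity of an estimate. *)
Lemma seeking_solvable th (s0 : V) :
  exists u : R -> V, ode_solution (F th) u /\ u 0 = s0.
Proof.
pose I := ('I_N + 'I_N * 'I_N)%type.
pose state (z : I -> R) : V :=
  (\row_j z (inl j), \matrix_(i, j) z (inr (i, j))).
pose coord (s : V) (k : I) : R :=
  match k with inl j => s.1 0 j | inr (i, j) => s.2 i j end.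
pose G (z : I -> R) : I -> R := coord (F th (state z)).
pose c i j : R := `|th * tb i j| * (4 * N%:R + 2).
pose K := L * N%:R + (\sum_i \sum_j c i j) + 1.
have c0 i j : 0 <= c i j by rewrite mulr_ge0// addr_ge0 ?mulr_ge0.
have LN0 : 0 <= L * N%:R by exact: mulr_ge0.
have sc0 : 0 <= \sum_i \sum_j c i j.
  by rewrite sumr_ge0// => ? _; rewrite sumr_ge0.
have K0 : 0 < K by rewrite ltr_wpDl// addr_ge0.
have G_lip z w (d : R) : (forall k, `|z k - w k| <= d) ->
    forall k, `|G z k - G w k| <= K * d.
  move=> zw.
  have sumd : \sum_(k < N) d = N%:R * d.
    by rewrite sumr_const card_ord mulr_natl.
  have d0 : 0 <= d by rewrite (le_trans _ (zw (inl (Ordinal N_ge2)))).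
  case=> [j|[i j]].
    rewrite -[G z _]/((F th (state z)).1 0 j) -[G w _]/((F th (state w)).1 0 j).
    rewrite !action_velocityE -opprD normrN.
    apply: le_trans (saturation_lipschitz U_gt0 _ _) _.
    apply: le_trans (P_lip _ _ _) _.
    apply: (@le_trans _ _ (L * N%:R * d)); last first.
      by rewrite ler_wpM2r // /K -addrA lerDl addr_ge0.
    rewrite -mulrA -sumd ler_wpM2l//; apply: ler_sum => k _.
    by rewrite !mxE; exact: zw.
  rewrite -[G z _]/((F th (state z)).2 i j) -[G w _]/((F th (state w)).2 i j).
  rewrite !estimate_velocityE -mulrBr normrM normrN.
  apply: (@le_trans _ _ (c i j * d)); last first.
    rewrite ler_wpM2r //.
    apply: (@le_trans _ _ (\sum_i \sum_j c i j)); last first.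
      by rewrite /K addrAC lerDr addr_ge0.
    rewrite (bigD1 i)//= (bigD1 j)//= -addrA lerDl addr_ge0//.
      by rewrite sumr_ge0.
    by rewrite sumr_ge0// => ? _; rewrite sumr_ge0.
  rewrite /c -mulrA ler_wpM2l//.
  pose dlt k := err (state z) k j - err (state w) k j.
  have dlt_le k : `|dlt k| <= 2 * d.
    rewrite /dlt /err /estimation_error !mxE.
    have := zw (inl j); have := zw (inr (k, j)).
    by rewrite !ler_norml => /andP[? ?] /andP[? ?]; apply/andP; split; lra.
  have a_le (i' k : 'I_N) (r b : R) : `|r| <= b -> `|a i' k * r| <= b.
    rewrite mxE; case: (e i' k); first by rewrite mul1r.
    by rewrite mul0r normr0 => /(le_trans _); apply.
  rewrite opprD addrACA -sumrB -mulrBr mulrDl.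
  apply: le_trans (ler_normD _ _) _; apply: lerD; last exact: a_le (dlt_le i).
  apply: le_trans (ler_norm_sum _ _ _) _.
  rewrite -mulrA -sumd mulr_sumr; apply: ler_sum => k _.
  rewrite (_ : _ - _ = a i k * (dlt i - dlt k)); last by rewrite /dlt; ring.
  apply: a_le; apply: le_trans (ler_normB _ _) _.
  by have := dlt_le i; have := dlt_le k; lra.
have [u [u0 uD]] := lipschitz_ode_exists K0 G_lip (coord s0).
have stateK s : state (coord s) = s.
  case: s => x y; congr pair; first by apply/rowP => j; rewrite mxE.
  by apply/matrixP => i j; rewrite mxE.
have sD (t : R) : 0 <= t ->
    is_derive t 1 (fun r => state (u r)) (F th (state (u t))).
  move=> t0; apply: is_derive_state => [j|i j].
    have -> : (fun r => (state (u r)).1 0 j) = (fun r => u r (inl j)).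
      by apply/funext => r; rewrite mxE.
    exact: (uD t (inl j) t0).
  have -> : (fun r => (state (u r)).2 i j) = (fun r => u r (inr (i, j))).
    by apply/funext => r; rewrite mxE.
  exact: (uD t (inr (i, j)) t0).
exists (fun r => state (u r)); split; last by rewrite u0 stateK.
split; last by move=> t /ltW; exact: sD.
apply: derivable_within_continuous => t; rewrite in_itv/= andbT => t0.
by have [] := sD t t0.
Qed.

Lemma seeking_globally_stable (xs : 'rV[R]_N) : P xs = 0 ->
  exists th_star : R, 0 < th_star /\ forall th : R, th_star < th ->
    globally_asymptotically_stable (F th) (consensus_state xs).
Proof.
move=> xs0; have [th_star [th_star0 rate_le]] := energy_rate_le.
exists th_star; split=> // th hth.
have th_rate s : energy_rate th s <= - (m / 2 * dissipation s).
  exact: rate_le.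
split.
- exact: seeking_equilibrium.
- exact: seeking_solvable.
- exact: seeking_stable.
- exact: seeking_attractive.
Qed.

End Seeking.

(** * Seeking a Nash equilibrium with saturated controls *)

Lemma pseudo_gradient_lipschitz (R : realType) (N : nat)
    (f : 'I_N -> 'rV[R]_N -> R) (M : R) :
  (forall i, class_C 2 (f i)) ->
  (forall x i j, `|game_hessian f x i j| <= M) ->
  forall x z i, `|pseudo_gradient f x 0 i - pseudo_gradient f z 0 i| <=
    M * \sum_j `|x 0 j - z 0 j|.
Proof.
move=> fC2 HM x z i; rewrite !mxE.
apply: (@coordinate_lipschitz _ _ (partial i (f i))) => {x z} x j t.
have [_ /= fd] := fC2 i.
apply: mixed_derive_lipschitz => [y|y|y|y].
- exact: (fd i).1.
- exact: (fd j).1.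
- by have [_ [_ /(_ i)[]]] := fd j.
- by have := HM y i j; rewrite mxE.
Qed.

Theorem theorem2 (R : realType) (N : nat) (hN : (2 <= N)%N)
    (f : 'I_N -> 'rV[R]_N -> R)
    (f_C2 : forall i : 'I_N, class_C 2 (f i))
    (e : rel 'I_N)
    (e_undirected : undirected_graph e)
    (e_connected : connected_graph e)
    (P_monotone : exists m : R, 0 < m /\
       forall x z : 'rV[R]_N,
         m * dotp (x - z) (x - z) <=
         dotp (x - z) (pseudo_gradient f x - pseudo_gradient f z))
    (H_bounded : exists M : R,
       forall (x : 'rV[R]_N) (i j : 'I_N), `|game_hessian f x i j| <= M)
    (U : R) (U_gt0 : 0 < U)
    (thetabar : 'I_N -> 'I_N -> R)
    (thetabar_gt0 : forall i j : 'I_N, 0 < thetabar i j) :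
  exists xstar : 'rV[R]_N,
    [/\ nash_equilibrium f xstar,
        forall z : 'rV[R]_N, nash_equilibrium f z -> z = xstar
      & exists theta_star : R, 0 < theta_star /\
          forall theta : R, theta_star < theta ->
            globally_asymptotically_stable
              (seeking_dynamics f (adjacency R e) U
                 (fun i j => theta * thetabar i j))
              (consensus_state xstar)].
Proof.
have [m [m0 mono]] := P_monotone; have [M HM] := H_bounded.
have M0 : 0 <= M by rewrite (le_trans _ (HM 0 (Ordinal hN) (Ordinal hN))).
have lip := pseudo_gradient_lipschitz f_C2 HM.
have fd i y : derivable (f i) y (delta_mx 0 i) by have [_ /(_ i)[]] := f_C2 i.
have mono0 y z : 0 <= dotp (y - z) (pseudo_gradient f y - pseudo_gradient f z).
  by apply: le_trans (mono y z); rewrite mulr_ge0 ?dotp_ge0// ltW.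
have nashP x := nash_equilibriumP x fd mono0.
have [xs xs0] := strongly_monotone_zero m0 M0 mono lip.
exists xs; split; first exact/nashP.
  move=> z /nashP z0; apply/eqP; rewrite -subr_eq0; apply/eqP/dotp_eq0.
  rewrite -(pmulr_rle0 _ m0); apply: le_trans (mono z xs) _.
  by rewrite z0 xs0 subrr /dotp big1// => i _; rewrite [X in _ * X]mxE mulr0.
have [e_sym _] := e_undirected.
exact: (seeking_globally_stable hN e_sym e_connected U_gt0 m0 M0 thetabar_gt0
  mono lip xs0).
Qed.
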